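(* Let $\mathcal K$ be a 3-dimensional simplicial complex embedded in $\mathbb R^3$ triangulating a closed bounded domain $\Omega$ with Lipschitz boundary that is homeomorphic to a closed 3-ball. Then $\mathcal K$ is collapsible if and only if there exists a complete acyclic matching of 1-chains on the canonical basis of $\mathcal K$.
   Context: Cells (simplices) of $\mathcal K$ are oriented; $\mathcal K_j$ is the set of $j$-simplices. The canonical basis of the chain complex consists of the simplices themselves. For an edge $e$ and a triangle $f$, write $e\prec f$ iff $e\subset\partial f$ (equivalently the face–edge incidence number is nonzero). A matching of 1-chains on the canonical basis is a set $\mathcal M_1$ of pairs $(e,f)$ with $e$ an edge, $f$ a triangle, $e\prec f$, such that every edge and every triangle belongs to at most one pair. It is acyclic if there is no cycle $f_1\succ e_1\prec f_2\succ\cdots\prec f_h\succ e_h\prec f_1$ with $h\ge2$, all $(e_i,f_i)\in\mathcal M_1$ and the $f_i$ distinct. It is complete if its number of pairs equals the rank of the face–edge incidence matrix $\mathbf C$ (entries $\pm1$ if $e\subset\partial f$ with sign given by orientation, $0$ otherwise). An elementary collapse removes from a complex a pair $(\sigma,\tau)$ of cells with $\sigma\subset\tau$, $\dim\sigma=\dim\tau-1$, such that $\tau$ is the only cell of the complex properly containing $\sigma$ (and hence $\tau$ is maximal). $\mathcal K$ is collapsible if a finite sequence of elementary collapses reduces it to a single vertex. *)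

(* Defs.v *)
From HB Require Import structures.
From mathcomp Require Import all_boot all_order all_algebra.
From mathcomp Require Import all_classical all_reals all_analysis.
Set Implicit Arguments. Unset Strict Implicit. Unset Printing Implicit Defensive.
Import Order.TTheory GRing.Theory Num.Theory.
Import numFieldNormedType.Exports.
Local Open Scope ring_scope.

Section Defs.
Variable V : finType.

Definition is_simplicial_complex (K : {set {set V}}) : Prop :=
  (@finset.set0 V) \notin K /\
  forall s t : {set V}, s \in K -> t \subset s -> t != @finset.set0 V -> t \in K.

Definition complex_dim (K : {set {set V}}) (d : nat) : Prop :=
  (exists s, s \in K /\ #|s| = d.+1) /\ (forall s, s \in K -> #|s| <= d.+1)%N.

Definition simplices (K : {set {set V}}) (j : nat) : {set {set V}} :=
  [set s in K | #|s| == j.+1].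

Definition elementary_collapse (K K' : {set {set V}}) : Prop :=
  exists s t : {set V},
    [/\ s \in K /\ t \in K, s \proper t, #|t| = #|s|.+1,
        (forall u, u \in K -> s \proper u -> u = t) &
        K' = (K :\ s) :\ t].

Inductive collapses_to (K : {set {set V}}) : {set {set V}} -> Prop :=
| collapses_refl : collapses_to K K
| collapses_step K1 K2 : collapses_to K K1 -> elementary_collapse K1 K2 ->
    collapses_to K K2.

Definition collapsible (K : {set {set V}}) : Prop :=
  exists v : V, collapses_to K [set [set v]].

(** Orientation and face-edge incidence. The orientation of every simplex is
    given relative to the reference orientation induced by the vertex order
    (enum_rank) of V: [or s = true] means the opposite orientation.
    For a triangle f = [v0 < v1 < v2] and an edge e = f minus v_i, the reference
    incidence is (-1)^i. *)
Definition ref_incidence_exp (e f : {set V}) : nat :=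
  (\sum_(v in f :\: e) #|[set u in f | enum_rank u < enum_rank v]|)%N.

Definition incidence (R : nzRingType) (or : {set V} -> bool) (e f : {set V}) : R :=
  if e \subset f then (-1) ^+ (or e + or f + ref_incidence_exp e f)%N else 0.

Definition face_edge_matrix (R : nzRingType) (K : {set {set V}}) (or : {set V} -> bool) :
  'M[R]_(#|simplices K 2|, #|simplices K 1|) :=
  \matrix_(i < #|simplices K 2|, j < #|simplices K 1|)
     incidence R or (enum_val j) (enum_val i).

Definition matching1 (K : {set {set V}}) (M : {set {set V} * {set V}}) : Prop :=
  [/\ (forall p, p \in M ->
         [/\ p.1 \in simplices K 1, p.2 \in simplices K 2 & p.1 \subset p.2]),
      (forall p q, p \in M -> q \in M -> p.1 = q.1 -> p = q) &
      (forall p q, p \in M -> q \in M -> p.2 = q.2 -> p = q)].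

(** Acyclic: no cycle f_1 > e_1 < f_2 > ... < f_h > e_h < f_1 with h >= 2,
    (e_i, f_i) in M and the f_i distinct.  The cycle is the sequence of pairs
    (e_i, f_i); the condition e_i < f_{i+1} is taken cyclically. *)
Definition acyclic1 (M : {set {set V} * {set V}}) : Prop :=
  ~ exists c : seq ({set V} * {set V}),
      [/\ (2 <= size c)%N, all (fun p => p \in M) c, uniq (map snd c) &
          forall i, (i < size c)%N ->
            (nth (@finset.set0 V, @finset.set0 V) c i).1 \subset (nth (@finset.set0 V, @finset.set0 V) c (i.+1 %% size c)).2].

Definition complete1 (R : fieldType) (K : {set {set V}}) (or : {set V} -> bool)
  (M : {set {set V} * {set V}}) : Prop :=
  #|M| = \rank (face_edge_matrix R K or).

End Defs.

Section GeomK.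
Local Open Scope classical_set_scope.
Variable V : finType.
Variable R : realType.

Definition conv_hull (pos : V -> 'rV[R]_3) (s : {set V}) : set 'rV[R]_3 :=
  [set x | exists w : V -> R,
     [/\ forall v, 0 <= w v, forall v, v \notin s -> w v = 0,
         \sum_v w v = 1 & x = \sum_v w v *: pos v]].

Definition aff_indep (pos : V -> 'rV[R]_3) (s : {set V}) : Prop :=
  forall w : V -> R, (forall v, v \notin s -> w v = 0) ->
    \sum_v w v = 0 -> \sum_v w v *: pos v = 0 -> forall v, w v = 0.

Definition geometric_realization (pos : V -> 'rV[R]_3) (K : {set {set V}}) : Prop :=
  (forall s, s \in K -> aff_indep pos s) /\
  (forall s t, s \in K -> t \in K ->
     conv_hull pos s `&` conv_hull pos t = conv_hull pos (s :&: t)).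

Definition polyhedron (pos : V -> 'rV[R]_3) (K : {set {set V}}) : set 'rV[R]_3 :=
  [set x | exists2 s, s \in K & conv_hull pos s x].

End GeomK.

Section Geom.
Local Open Scope classical_set_scope.
Variable R : realType.

Definition edist (x y : 'rV[R]_3) : R := Num.sqrt (\sum_i (x ord0 i - y ord0 i) ^+ 2).

Definition closed_unit_ball : set 'rV[R]_3 := [set x | \sum_i (x ord0 i) ^+ 2 <= 1].

Definition homeomorphic (A B : set 'rV[R]_3) : Prop :=
  exists f g : 'rV[R]_3 -> 'rV[R]_3,
    [/\ f @` A `<=` B /\ g @` B `<=` A,
        (forall x, A x -> g (f x) = x), (forall y, B y -> f (g y) = y),
        {within A, continuous f} & {within B, continuous g}].

Definition lipschitz2 (g : R -> R -> R) : Prop :=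
  exists L : R, forall a b c d,
    `|g a b - g c d| <= L * Num.sqrt ((a - c) ^+ 2 + (b - d) ^+ 2).

Definition lipschitz_boundary (O : set 'rV[R]_3) : Prop :=
  forall x, (closure O `\` interior O) x ->
    exists (r : R) (Q : 'M[R]_3) (g : R -> R -> R),
      [/\ 0 < r, Q *m Q^T = 1%:M, lipschitz2 g &
          forall y, edist y x < r ->
            (O y <-> let z := (y - x) *m Q in
                     z ord0 (inord 2) <= g (z ord0 (inord 0)) (z ord0 (inord 1)))].

End Geom.

(* Main.v *)
(** The topological input is that the reduced simplicial cohomology of K mod 2 vanishes.
   A simplicial cocycle becomes a cocycle on small tuples of points of |K| once every point is
   labelled by a vertex that belongs to all simplices near it. Transported to the ball, it gets
   a primitive from the homotopy x |-> (j/N) x, taken in N small steps so that all tuples stay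
   small. Pulling the primitive back to K along an iterated barycentric subdivision gives a
   simplicial primitive, by Sperner's lemma.

   Let C have rank r and let n_j count the j-simplices. Integer minors compare the real and
   the mod 2 rank, and exactness gives r + n_0 = n_1 + 1 and n_2 <= r + n_3. The pairs removed
   by a collapse form an acyclic matching, which contains n_1 + 1 - n_0 edge-triangle pairs.
   Conversely, let a complete acyclic matching be given. By Radon's argument a triangle of an
   embedded complex lies in at most two tetrahedra. As long as tetrahedra are left, the boundary
   of their sum mod 2 is a nonempty cycle, which acyclicity prevents from consisting of matched
   triangles, so a tetrahedron can be removed through an unmatched triangle. There are at most
   n_3 unmatched triangles, so only matched ones remain, and acyclicity lets them collapse
   through their edges. What is left is a connected graph with n_0 vertices and n_0 - 1 edges. *)
Require Import Defs.
From mathcomp Require Import all_boot all_order all_algebra.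
From mathcomp Require Import boolp ring zify.
Set Implicit Arguments. Unset Strict Implicit. Unset Printing Implicit Defensive.
Import Order.TTheory GRing.Theory Num.Theory.
Local Open Scope ring_scope.

(** * Cochains mod 2 *)

Lemma addrr_F2 (x : 'F_2) : x + x = 0.
Proof. by rewrite addrr_pchar2 // pchar_Fp. Qed.

Lemma mulrn_F2 (x : 'F_2) n : x *+ n = x *+ odd n.
Proof. by rewrite -{1}(odd_double_half n) mulrnDr -mul2n mulrnA mulr2n addrr_F2 mul0rn addr0. Qed.

Section ListCochains.
Variable T : eqType.
Implicit Types (a b : seq T -> 'F_2) (xs ys : seq T).

(* The empty list is allowed as an argument, so the cohomology is the reduced one. *)
Fixpoint cobd a xs : 'F_2 :=
  if xs is x :: xs' then a xs' + cobd (fun ys => a (x :: ys)) xs' else 0.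

Lemma eq_in_cobd a b xs :
  (forall ys, size ys = (size xs).-1 -> {subset ys <= xs} -> a ys = b ys) ->
  cobd a xs = cobd b xs.
Proof.
elim: xs a b => [|x xs IH] a b eq_ab //=.
rewrite eq_ab //; last by move=> y ys; rewrite inE ys orbT.
congr (_ + _); case: xs IH eq_ab => [//|x' xs] IH eq_ab; apply: IH => ys sz sub.
apply: eq_ab => [|y]; first by rewrite /= sz.
by rewrite !inE => /orP[->//|/sub]; rewrite inE => ->; rewrite orbT.
Qed.

Lemma cobd_const (z : 'F_2) xs : cobd (fun=> z) xs = z *+ size xs.
Proof. by elim: xs => //= x xs ->; rewrite mulrS. Qed.

Lemma cobd_nseq a n x : cobd a (nseq n.+1 x) = a (nseq n x) *+ n.+1.
Proof.
elim: n a => [|n IH] a; first by rewrite /= addr0.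
rewrite -[LHS]/(a (nseq n.+1 x) + cobd (fun ys => a (x :: ys)) (nseq n.+1 x)).
by rewrite IH [RHS]mulrS.
Qed.

Lemma cobdD a b xs : cobd (fun ys => a ys + b ys) xs = cobd a xs + cobd b xs.
Proof.
elim: xs a b => [|x xs IH] a b /=; first by rewrite addr0.
by rewrite (IH (fun ys => a (x :: ys))) addrACA.
Qed.

Lemma cobd_sum I (r : seq I) (A : I -> seq T -> 'F_2) xs :
  cobd (fun ys => \sum_(i <- r) A i ys) xs = \sum_(i <- r) cobd (A i) xs.
Proof.
elim: xs A => [|x xs IH] A /=; first by rewrite big1.
by rewrite (IH (fun i ys => A i (x :: ys))) big_split.
Qed.

Lemma cobdK a xs : cobd (cobd a) xs = 0.
Proof. by elim: xs a => [|x xs IH] a //=; rewrite cobdD IH addr0 addrr_F2. Qed.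

Section Prism.
Variables f g : T -> T.

(* Pull-back of [a] along the triangulated homotopy from [f] to [g]. *)
Fixpoint prism a xs : 'F_2 :=
  if xs is x :: xs' then
    a [:: f x, g x & map g xs'] + prism (fun ys => a (f x :: ys)) xs'
  else 0.

Lemma prismD a b xs : prism (fun ys => a ys + b ys) xs = prism a xs + prism b xs.
Proof.
elim: xs a b => [|x xs IH] a b /=; first by rewrite addr0.
by rewrite (IH (fun ys => a (f x :: ys))) addrACA.
Qed.

Lemma prism_eq0 a xs :
  (forall ys, size ys = (size xs).+1 -> {subset ys <= map f xs ++ map g xs} -> a ys = 0) ->
  prism a xs = 0.
Proof.
elim: xs a => [|x xs IH] a a0 //=.
rewrite a0 /= ?size_map // ?add0r => [|y]; last first.
  by rewrite !inE mem_cat inE => /or3P[->|->|->]; rewrite ?orbT.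
apply: IH => ys size_ys sub; apply: a0 => [|y]; first by rewrite /= size_ys.
rewrite inE /= => /predU1P[->|/sub]; first by rewrite inE eqxx.
by rewrite inE !mem_cat inE => /orP[]->; rewrite ?orbT.
Qed.

End Prism.

End ListCochains.

Lemma cobd_comp_map (T U : eqType) (h : U -> T) (a : seq T -> 'F_2) us :
  cobd (fun ys => a (map h ys)) us = cobd a (map h us).
Proof. by elim: us a => [|u us IH] a //=; rewrite -IH. Qed.

Lemma cobd_prism (T : eqType) (f g : T -> T) a xs :
  cobd (prism f g a) xs + prism f g (cobd a) xs = a (map f xs) + a (map g xs).
Proof.
elim: xs a => [|x xs IH] a /=; first by rewrite addr0 addrr_F2.
rewrite cobdD prismD (cobd_comp_map g (fun ys => a [:: f x, g x & ys])).
have := IH (fun ys => a (f x :: ys)) => /=.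
move: (a (f x :: map g xs)) (cobd (prism _ _ _) _) (prism _ _ (cobd _) _) => afg dp pd dp_pd.
rewrite (AC ((1*2)*((1*2)*2)) ((1*7)*(2*6)*(3*8)*(5*4))) /= !addrr_F2 !add0r dp_pd.
by rewrite addrA -(addrA _ afg afg) addrr_F2 addr0.
Qed.

Section Subdivision.
Variables (T : eqType) (bary : seq T -> T).
Implicit Types (a b : seq T -> 'F_2) (xs ys : seq T).

(* [sdn n] is meaningful on lists of size [n] only: it pulls [b] back along the
   barycentric subdivision, i.e. the cone from [bary xs] over the subdivided boundary. *)
Fixpoint sdn n b xs : 'F_2 :=
  if n is m.+1 then cobd (sdn m (fun ys => b (bary xs :: ys))) xs else b xs.

Definition sd b xs := sdn (size xs) b xs.

Lemma sdnD n a b xs : sdn n (fun ys => a ys + b ys) xs = sdn n a xs + sdn n b xs.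
Proof.
elim: n a b xs => [//|n IH] a b xs /=.
by rewrite -cobdD; apply: eq_in_cobd => ys _ _; rewrite -IH.
Qed.

Lemma sdn_cobd n b xs : size xs = n.+1 -> sdn n.+1 (cobd b) xs = cobd (sdn n b) xs.
Proof.
elim: n b xs => [|n IH] b xs size_xs.
  by case: xs size_xs => // x [] //= _; rewrite !addr0.
change (cobd (sdn n.+1 (fun ys => b ys + cobd (fun zs => b (bary xs :: zs)) ys)) xs =
        cobd (sdn n.+1 b) xs).
rewrite -[RHS]addr0 -(cobdK (sdn n (fun ys => b (bary xs :: ys))) xs) -cobdD.
apply: eq_in_cobd => ys; rewrite size_xs => size_ys _.
by rewrite -(IH (fun zs => b (bary xs :: zs))) // -sdnD.
Qed.

Lemma sd_cobd b : sd (cobd b) = cobd (sd b).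
Proof.
apply: funext => xs; rewrite /sd; case size_xs: (size xs) => [|n].
  by move/size0nil: size_xs => ->.
by rewrite sdn_cobd //; apply: eq_in_cobd => ys; rewrite size_xs => /= ->.
Qed.

Lemma iter_sd_cobd N b : iter N sd (cobd b) = cobd (iter N sd b).
Proof. by elim: N => //= N ->; rewrite sd_cobd. Qed.

Lemma iter_sd_nil N b : iter N sd b [::] = b [::].
Proof. by elim: N. Qed.

End Subdivision.

Section SimplicialCochains.
Variable V : finType.
Implicit Types (b c : {set V} -> 'F_2) (u v : V) (vs : seq V) (s t : {set V}).

Definition scobd b s : 'F_2 := \sum_(v in s) b (s :\ v).

Lemma scobd_set2 c u v : u != v -> scobd c [set u; v] = c [set u] + c [set v].
Proof.
move=> uv; rewrite /scobd big_setU1 ?inE //= big_set1 addrC setU1K ?inE //.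
by rewrite setUC setU1K // inE eq_sym.
Qed.

Definition list_cochain c vs : 'F_2 := if uniq vs then c [set:: vs] else 0.

Lemma cobd_list_cochain b vs : cobd (list_cochain b) vs = list_cochain (scobd b) vs.
Proof.
elim: vs b => [|v vs IH] b /=.
  by rewrite /list_cochain /= /scobd set_nil big_set0.
pose bv s := if v \in s then 0 else b (v |: s).
have -> : (fun ys => list_cochain b (v :: ys)) = list_cochain bv.
  apply: funext => ys; rewrite /list_cochain /= /bv inE set_cons.
  by case: (v \in ys) => //=; case: ifP.
rewrite IH /list_cochain /=; case: ifP => [uniq_vs|]; last by rewrite andbF addr0.
rewrite andbT set_cons; set s := [set:: vs].
have -> : (v \in vs) = (v \in s) by rewrite inE.
have [vs'|vs'] /= := boolP (v \in s).
  rewrite /scobd (bigD1 v) //= big1 ?addr0 => [|w /andP[ws wv]].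
    by rewrite /bv in_setD1 eqxx /= setD1K // addrr_F2.
  by rewrite /bv in_setD1 eq_sym wv vs'.
rewrite /scobd big_setU1 //= setU1K //; congr (_ + _); apply: eq_bigr => w ws.
have wv : w != v by apply: contraNneq vs' => <-.
rewrite /bv in_setD1 (negPf vs') andbF; congr b; apply/setP => x; rewrite !inE.
by have [->|] //= := eqVneq x v; rewrite eq_sym wv.
Qed.

Lemma set_enum s : [set:: enum s] = s.
Proof. by apply/setP => v; rewrite inE mem_enum. Qed.

Lemma scobdK b t : scobd (scobd b) t = 0.
Proof.
have listE c : list_cochain c (enum t) = c t by rewrite /list_cochain enum_uniq set_enum.
rewrite -listE -cobd_list_cochain -[RHS](cobdK (list_cochain b) (enum t)).
by congr cobd; apply: funext => vs; rewrite cobd_list_cochain.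
Qed.

Lemma cobd_uniq (g : seq V -> 'F_2) vs : uniq vs ->
  cobd g vs = \sum_(v <- vs) g (rem v vs).
Proof.
elim: vs g => [|v vs IH] g /=; first by rewrite big_nil.
case/andP=> v_vs uniq_vs; rewrite big_cons /= eqxx IH //; congr (_ + _).
apply: eq_big_seq => w w_vs; case: eqP => // vw; by rewrite vw w_vs in v_vs.
Qed.

Lemma cobd_enum (g : seq V -> 'F_2) s :
  cobd g (enum s) = \sum_(v in s) g (enum (s :\ v)).
Proof.
rewrite cobd_uniq ?enum_uniq // big_enum; apply: eq_bigr => v vs.
congr g; rewrite rem_filter ?enum_uniq // [in LHS]/enum_mem -filter_predI.
by apply: eq_filter => x; rewrite /= !inE.
Qed.

End SimplicialCochains.

Section Facets.
Variable V : finType.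
Implicit Types (b : {set V} -> 'F_2) (s t : {set V}) (S : {set {set V}}).

Definition facet s t := (s \subset t) && (#|t| == #|s|.+1).

Lemma facetP s t : reflect (exists2 v, v \in t & s = t :\ v) (facet s t).
Proof.
apply: (iffP andP) => [[st /eqP card_t]|[v vt ->]].
  have /cards1P[v v_def] : #|t :\: s| == 1%N by rewrite cardsDS // card_t subSnn.
  exists v; first by have := set11 v; rewrite -v_def inE => /andP[].
  by rewrite -v_def setDDr setDv set0U (setIidPr st).
by rewrite subD1set [in X in X == _](cardsD1 v t) vt.
Qed.

Lemma facet_proper s t : facet s t -> s \proper t.
Proof. by case/andP=> st /eqP card_t; rewrite properEcard st card_t /=. Qed.

Lemma facets_imset t : [set s | facet s t] = [set t :\ v | v in t].
Proof. by apply/setP => s; rewrite inE; apply/facetP/imsetP. Qed.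

Lemma setD1_inj t : {in t &, injective (fun v => t :\ v)}.
Proof. by move=> u v ut vt /setP/(_ u); rewrite !inE eqxx ut andbT; case: eqP. Qed.

Lemma card_facets t : #|[set s | facet s t]| = #|t|.
Proof. by rewrite facets_imset card_in_imset //; exact: setD1_inj. Qed.

Lemma sum_facets (U : nmodType) (F : {set V} -> U) t :
  \sum_(s : {set V} | facet s t) F s = \sum_(v in t) F (t :\ v).
Proof.
rewrite -[RHS](big_imset F) /=; last exact: setD1_inj.
by rewrite -facets_imset; apply: eq_bigl => s; rewrite inE.
Qed.

Definition bd S : {set {set V}} := [set s | odd #|[set t in S | facet s t]|].

Lemma sum_scobd S b : \sum_(t in S) scobd b t = \sum_(s in bd S) b s.
Proof.
under eq_bigr => t _ do rewrite /scobd -sum_facets big_mkcond.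
rewrite exchange_big [RHS]big_mkcond; apply: eq_bigr => s _; rewrite -big_mkcondr inE.
rewrite (eq_bigl (mem [set t in S | facet s t])) => [|t]; last by rewrite !inE.
by rewrite sumr_const mulrn_F2; case: odd.
Qed.

Lemma sum_indicator S s : \sum_(t in S) (t == s)%:R = (s \in S)%:R :> 'F_2.
Proof.
have [sS|sS] := boolP (s \in S).
  by rewrite (bigD1 s) //= eqxx big1 ?addr0 // => t /andP[_ /negPf->].
by rewrite big1 // => t tS; case: eqP => // ts; rewrite -ts tS in sS.
Qed.

Lemma bdK S : bd (bd S) = set0.
Proof.
apply/setP => s; rewrite in_set0; apply/negP => s_bd.
have := sum_indicator (bd (bd S)) s.
rewrite s_bd -!sum_scobd big1 => [/eqP|t _]; last exact: scobdK.
by rewrite eq_sym oner_eq0.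
Qed.

End Facets.

(** * Collapses and matchings *)

Section Complexes.
Variable V : finType.
Implicit Types (K : {set {set V}}) (s t u : {set V}).

Lemma simplicesP K j s : reflect (s \in K /\ #|s| = j.+1) (s \in simplices K j).
Proof. by rewrite inE; apply: (iffP andP) => -[? /eqP]. Qed.

Lemma simplices0P K s : reflect (exists2 v, s = [set v] & [set v] \in K) (s \in simplices K 0).
Proof.
apply: (iffP (simplicesP K 0 s)) => [[sK /eqP/cards1P[v sv]]|[v -> vK]].
  by exists v; rewrite -?sv.
by rewrite cards1.
Qed.

Lemma simplicesS K K' j : K' \subset K -> simplices K' j \subset simplices K j.
Proof.
move=> /subsetP K'K; apply/subsetP => s /simplicesP[/K'K sK card_s].
exact/simplicesP.
Qed.

Lemma complex_card_gt0 K s : is_simplicial_complex K -> s \in K -> (0 < #|s|)%N.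
Proof. by case=> K0 _ sK; rewrite card_gt0; apply: contraNneq K0 => <-. Qed.

Lemma complex_down K s t : is_simplicial_complex K -> t \in K -> s \subset t ->
  (0 < #|s|)%N -> s \in K.
Proof. by case=> _ down tK st; rewrite card_gt0; apply: down st. Qed.

Lemma complex_vertex K s v : is_simplicial_complex K -> s \in K -> v \in s -> [set v] \in K.
Proof. by move=> Kcx sK vs; apply: complex_down sK _ _; rewrite ?sub1set ?cards1. Qed.

Definition dim_le K d := forall s, s \in K -> (#|s| <= d.+1)%N.

Lemma dim_leS K K' d : K' \subset K -> dim_le K d -> dim_le K' d.
Proof. by move=> /subsetP K'K Kd s /K'K/Kd. Qed.

Lemma dim_le_pred K d : dim_le K d.+1 -> simplices K d.+1 = set0 -> dim_le K d.
Proof.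
move=> Kd top0 s sK; have := Kd s sK; rewrite leq_eqVlt => /predU1P[card_s|//].
by have : s \in simplices K d.+1; [exact/simplicesP | rewrite top0 inE].
Qed.

(* Simplices are counted by their vertices: the condition concerns degree [n - 1]. *)
Definition exact_at K n := forall c : {set V} -> 'F_2,
  (forall t, t \in K -> #|t| = n.+1 -> scobd c t = 0) ->
  exists b, forall s, s \in K -> #|s| = n -> scobd b s = c s.

Lemma exact_at_top_cycle K d (S : {set {set V}}) : dim_le K d -> exact_at K d.+1 ->
  S \subset simplices K d -> bd S = set0 -> S = set0.
Proof.
move=> Kd ex /subsetP SK bdS; apply/setP => s; rewrite in_set0; apply/negP => sS.
have [t tK card_t|b b_s] := ex (fun u => (u == s)%:R).
  by have := Kd t tK; rewrite card_t ltnn.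
have := sum_scobd S b; rewrite bdS big_set0.
rewrite (eq_bigr (fun t => (t == s)%:R)) => [|t /SK/simplicesP[tK]]; last exact: b_s.
by move/eqP; rewrite sum_indicator sS oner_eq0.
Qed.

End Complexes.

Section Collapses.
Variable V : finType.
Implicit Types (K : {set {set V}}) (s t u : {set V}).

Definition free_face K s t :=
  [/\ s \in K, t \in K, facet s t & forall u, u \in K -> s \proper u -> u = t].

Lemma elementary_collapseP K K' : elementary_collapse K K' <->
  exists s t, free_face K s t /\ K' = K :\ s :\ t.
Proof.
split=> [[s [t [[sK tK] st card_t free ->]]]|[s [t [[sK tK st free] ->]]]].
  by exists s, t; rewrite /free_face /facet sK tK proper_sub ?card_t // eqxx.
by exists s, t; rewrite sK tK facet_proper //; case/andP: st => _ /eqP.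
Qed.

Lemma free_face_collapse K s t : free_face K s t -> collapses_to K (K :\ s :\ t).
Proof.
move=> free; apply: (collapses_step (collapses_refl K)).
by apply/elementary_collapseP; exists s, t.
Qed.

Lemma free_face_complex K s t :
  is_simplicial_complex K -> free_face K s t -> is_simplicial_complex (K :\ s :\ t).
Proof.
move=> [K0 down] [sK tK /facet_proper st free]; split.
  by rewrite !inE (negPf K0) !andbF.
move=> u w; rewrite !inE => /and3P[ut us uK] wu w0.
have su : ~~ (s \proper u) by apply: contraNN ut => su; rewrite (free u).
rewrite (down u) // andbT; apply/andP; split; apply: contraNneq su => w_def.
  by apply: proper_sub_trans st _; rewrite -w_def.
by rewrite properEneq eq_sym us -w_def.
Qed.

Lemma free_face_top K d s t : dim_le K d.+1 -> s \in simplices K d -> t \in K -> facet s t ->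
  (forall u, u \in simplices K d.+1 -> s \subset u -> u = t) -> free_face K s t.
Proof.
move=> Kd /simplicesP[sK card_s] tK st free; split=> // u uK su; apply: free.
  by apply/simplicesP; split=> //; apply/eqP; rewrite eqn_leq Kd // -card_s proper_card.
exact: proper_sub.
Qed.

Lemma collapses_trans K K1 K2 :
  collapses_to K K1 -> collapses_to K1 K2 -> collapses_to K K2.
Proof. by move=> KK1; elim=> // K3 K4 _ KK3; exact: collapses_step. Qed.

Lemma collapses_complex K K' :
  is_simplicial_complex K -> collapses_to K K' -> is_simplicial_complex K'.
Proof.
move=> Kcx; elim=> // K1 K2 _ K1cx /elementary_collapseP[s [t [free ->]]].
exact: free_face_complex.
Qed.

Lemma collapses_sub K K' : collapses_to K K' -> K' \subset K.
Proof.
elim=> // K1 K2 _ K1K /elementary_collapseP[s [t [_ ->]]].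
exact: subset_trans (subset_trans (subD1set _ _) (subD1set _ _)) K1K.
Qed.

Lemma simplices_remove K s t j : simplices (K :\ s :\ t) j = simplices K j :\ s :\ t.
Proof. by apply/setP => u; rewrite !inE !andbA. Qed.

Lemma simplices_remove_other K s t j : #|s| != j.+1 -> #|t| != j.+1 ->
  simplices (K :\ s :\ t) j = simplices K j.
Proof.
move=> sj tj; apply/setP => u; rewrite simplices_remove !inE.
have [->|_] := eqVneq u t; first by rewrite (negPf tj) andbF.
by have [->|_] := eqVneq u s; rewrite ?(negPf sj) ?andbF.
Qed.

Lemma card_simplices_remove K s t j : free_face K s t ->
  #|simplices K j| = ((#|s| == j.+1) + (#|t| == j.+1) + #|simplices (K :\ s :\ t) j|)%N.
Proof.
case=> sK tK /facet_proper st _.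
rewrite simplices_remove (cardsD1 s) (cardsD1 t (_ :\ s)) !inE sK tK /= addnA.
by have -> : t != s by apply: contraTneq st => ->; rewrite properxx.
Qed.

Lemma collapse_dimension (Inv : {set {set V}} -> Prop) j K :
  (forall K1, collapses_to K K1 -> Inv K1 -> simplices K1 j.+1 != set0 ->
     exists s t, [/\ free_face K1 s t, #|s| = j.+1 & Inv (K1 :\ s :\ t)]) ->
  Inv K ->
  exists K', [/\ collapses_to K K', Inv K', simplices K' j.+1 = set0,
    #|simplices K j| = (#|simplices K' j| + #|simplices K j.+1|)%N &
    forall i, i != j -> i != j.+1 -> simplices K' i = simplices K i].
Proof.
move n_def: #|simplices K j.+1| => n.
elim: n K n_def => [|n IH] K n_def step KI.
  exists K; split => //; first exact: collapses_refl.
    by apply/eqP; rewrite -cards_eq0 n_def.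
  by rewrite addn0.
have [|s [t [free card_s K1I]]] := step K (collapses_refl K) KI.
  by rewrite -card_gt0 n_def.
have KK1 := free_face_collapse free; set K1 := K :\ s :\ t in KK1 K1I.
have card_t : #|t| = j.+2 by case: (free) => _ _ /andP[_ /eqP ->] _; rewrite card_s.
have card_top := card_simplices_remove j.+1 free.
have card_j := card_simplices_remove j free.
rewrite card_s card_t -/K1 !eqxx ?(ltn_eqF (ltnSn _)) ?(gtn_eqF (ltnSn _)) in card_top card_j.
have [|K2 /(collapses_trans KK1) KK2|//|K' [K1K' K'I top0 card_K' other]] := IH K1.
- by move: card_top; rewrite n_def => -[].
- exact: step.
exists K'; split=> //; first exact: collapses_trans KK1 K1K'.
  by rewrite card_j card_K' addnS.
by move=> i ij ij1; rewrite other // simplices_remove_other // ?card_s ?card_t eqSS eq_sym.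
Qed.

End Collapses.

Section EdgeConnectivity.
Variable V : finType.
Implicit Types (K : {set {set V}}) (s t : {set V}) (u v : V) (P : {pred V}).

Definition edge_rel K : rel V := [rel u v | [set u; v] \in K].

Definition edge_connected K :=
  forall u v, [set u] \in K -> [set v] \in K -> connect (edge_rel K) u v.

Lemma edge_connectedP K : edge_connected K <->
  forall P, closed (edge_rel K) P ->
    forall u v, [set u] \in K -> [set v] \in K -> (u \in P) = (v \in P).
Proof.
split=> [K_conn P P_closed u v uK vK|same u v uK vK].
  exact: closed_connect P_closed _ _ (K_conn u v uK vK).
have sym : connect_sym (edge_rel K) by apply: sym_connect_sym => x y; rewrite /edge_rel /= setUC.
have := same _ (connect_closed sym u) u v uK vK.
by rewrite [u \in _]connect0 => /esym.
Qed.

Lemma edge_connected_remove_leaf K u v : u != v -> free_face K [set u] [set u; v] ->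
  edge_connected K -> edge_connected (K :\ [set u] :\ [set u; v]).
Proof.
move=> uv [uK uvK _ free] /edge_connectedP K_conn; apply/edge_connectedP => P P_closed.
have leaf w : [set u; w] \in K -> w != u -> w = v.
  move=> uwK wu; have /setP/(_ w) : [set u; w] = [set u; v].
    by apply: free => //; rewrite properEcard sub1set set21 cards1 cards2 eq_sym wu.
  by rewrite !inE eqxx orbT (negPf wu) /= => /esym/eqP.
pose Q : pred V := [pred w | if w == u then v \in P else w \in P].
have Q_closed : closed (edge_rel K) Q.
  move=> x y xyK; rewrite !inE; have [xu|xu] := eqVneq x u; have [yu|yu] := eqVneq y u => //.
  - by rewrite (leaf y) // -xu.
  - by rewrite (leaf x) // -yu setUC.
  apply: P_closed; rewrite /edge_rel /= !inE [_ \in K]xyK andbT.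
  by apply/andP; split; apply/eqP => /setP/(_ u);
    rewrite !inE eqxx !(eq_sym u) (negPf xu) (negPf yu).
move=> x y; rewrite !inE => /and3P[_ xu xK] /and3P[_ yu yK].
have := K_conn Q Q_closed x y xK yK; rewrite !inE.
by rewrite !(inj_eq set1_inj) in xu yu; rewrite (negPf xu) (negPf yu).
Qed.

Lemma edge_connected_remove K s t : is_simplicial_complex K -> free_face K s t ->
  (1 < #|s|)%N -> edge_connected K -> edge_connected (K :\ s :\ t).
Proof.
move=> Kcx [sK tK st free] s1 /edge_connectedP K_conn.
have card_t : (2 < #|t|)%N by case/andP: st => _ /eqP ->.
have /subsetPn[r rt rs] : ~~ (t \subset s) by case/andP: (facet_proper st).
have neq_t (e : {set V}) : (#|e| <= 2)%N -> e != t by apply: contraTneq => ->; rewrite -ltnNge.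
apply/edge_connectedP => P P_closed x y; rewrite !inE => /and3P[_ _ xK] /and3P[_ _ yK].
apply: K_conn xK yK => p q pqK.
have card_pq : (#|[set p; q]| <= 2)%N by rewrite cards2; case: eqP.
have [s_pq|pq_s] := eqVneq [set p; q] s; last first.
  by apply: P_closed; rewrite /edge_rel /= !inE pq_s neq_t.
(* The edge [s] is bypassed through the vertex [r] of [t]. *)
have apex w : w \in s -> (w \in P) = (r \in P).
  move=> ws; have wt : w \in t by case/andP: st => /subsetP/(_ w ws).
  have card_wr : (#|[set w; r]| <= 2)%N by rewrite cards2; case: eqP.
  apply: P_closed; rewrite /edge_rel /= !inE neq_t //=; apply/andP; split.
    by apply: contraNneq rs => <-; rewrite set22.
  apply: complex_down tK _ _ => //; last by rewrite cards2.
  by apply/subsetP => z /set2P[]->.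
by rewrite !apex // -s_pq !inE eqxx ?orbT.
Qed.

Lemma collapses_edge_connected K K' : is_simplicial_complex K -> collapses_to K K' ->
  edge_connected K -> edge_connected K'.
Proof.
move=> Kcx; elim=> // K1 K2 KK1 IH /elementary_collapseP[s [t [free ->]]] /IH K1_conn.
have K1cx := collapses_complex Kcx KK1; have [sK _ st _] := free.
have [s1|s1] := ltnP 1 #|s|; first exact: edge_connected_remove.
have /cards1P[u s_def] : #|s| == 1%N by rewrite eqn_leq s1 (complex_card_gt0 K1cx).
have [v vs t_def] : exists2 v, v \notin s & t = s :|: [set v].
  case/facetP: st => v vt s_t; exists v; first by rewrite s_t !inE eqxx.
  by rewrite s_t setUC setD1K.
subst s t; apply: edge_connected_remove_leaf => //; by rewrite inE eq_sym in vs.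
Qed.

End EdgeConnectivity.

Lemma cycle_nthP (T : Type) (e : rel T) x0 c :
  reflect (forall i, (i < size c)%N -> e (nth x0 c i) (nth x0 c (i.+1 %% size c)%N)) (cycle e c).
Proof.
case: c => [|x c] /=; first by left.
have next i : (i < size (x :: c))%N ->
    nth x0 (rcons c x) i = nth x0 (x :: c) (i.+1 %% (size c).+1)%N.
  rewrite nth_rcons ltnS leq_eqVlt => /predU1P[->|ic]; first by rewrite ltnn eqxx modnn.
  by rewrite ic modn_small.
apply: (iffP (pathP x0)) => e_c i ic; have := e_c i.
  by rewrite size_rcons -rcons_cons nth_rcons ic next //; apply.
by rewrite size_rcons in ic; rewrite -rcons_cons nth_rcons ic next //; apply.
Qed.

Lemma card_sep_setU1 (T : finType) (A : {set T}) a (P : pred T) : a \notin A ->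
  #|[set x in a |: A | P x]| = (P a + #|[set x in A | P x]|)%N.
Proof. by move=> aA; rewrite -!sum1dep_card !big_mkcondr big_setU1. Qed.

Section AcyclicMatchings.
Variable V : finType.
Implicit Types (K : {set {set V}}) (s t : {set V}) (p q : {set V} * {set V}).
Implicit Types M : {set {set V} * {set V}}.

Definition facet_matching K M :=
  [/\ forall p, p \in M -> [/\ p.1 \in K, p.2 \in K & facet p.1 p.2],
      {in M &, injective fst} & {in M &, injective snd}].

Definition matching K j M :=
  [/\ forall p, p \in M -> [/\ p.1 \in simplices K j, p.2 \in simplices K j.+1 & p.1 \subset p.2],
      {in M &, injective fst} & {in M &, injective snd}].

Lemma matching_facet K j M p : matching K j M -> p \in M -> facet p.1 p.2.
Proof.
case=> M_pairs _ _ /M_pairs[/simplicesP[_ card_p1] /simplicesP[_ card_p2]].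
by rewrite /facet card_p1 card_p2 eqxx andbT.
Qed.

Lemma facet_matching_dim K j M : facet_matching K M ->
  matching K j [set p in M | #|p.1| == j.+1].
Proof.
case=> M_pairs fst_inj snd_inj; split=> [p|p q|p q]; rewrite !inE.
- case/andP=> /M_pairs[p1K p2K /andP[p12 /eqP card_p2]] card_p1.
  by rewrite p1K p2K card_p2 eqSS.
- by move=> /andP[pM _] /andP[qM _]; exact: fst_inj.
- by move=> /andP[pM _] /andP[qM _]; exact: snd_inj.
Qed.

Definition facing : rel ({set V} * {set V}) := fun p q => p.1 \subset q.2.

Lemma acyclic1P M : acyclic1 M <->
  forall c, (1 < size c)%N -> {subset c <= M} -> uniq (map snd c) -> ~~ cycle facing c.
Proof.
split=> [acM c c1 /allP cM uniq_c|acM [c [c1 /allP cM uniq_c c_cycle]]].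
  apply/negP => c_cycle; apply: acM; exists c; split=> //; exact/(@cycle_nthP _ facing).
by have /negP := acM c c1 cM uniq_c; apply; apply/(@cycle_nthP _ facing (set0, set0)).
Qed.

Lemma acyclic1_sub M M' : M' \subset M -> acyclic1 M -> acyclic1 M'.
Proof.
move=> /subsetP M'M /acyclic1P acM; apply/acyclic1P => c c1 cM'.
by apply: acM => // p /cM'/M'M.
Qed.

Lemma acyclic1_setU1 M p : acyclic1 M -> (forall q, q \in M -> ~~ (q.1 \subset p.2)) ->
  acyclic1 (p |: M).
Proof.
move=> /acyclic1P acM Mp; apply/acyclic1P => c c1 cM uniq_c; apply/negP => c_cycle.
have [/rot_to[i c' c_rot]|pc] := boolP (p \in c); last first.
  apply/negP: c_cycle; apply: acM => // q qc; have := cM q qc.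
  by rewrite !inE => /predU1P[qp|//]; rewrite -qp qc in pc.
have [q q_last] : exists q, last p c' = q by exists (last p c').
have [pc' qc'] : p \notin c' /\ q \in c'.
  have := map_uniq uniq_c; rewrite -(rot_uniq i) c_rot => /andP[-> _]; split=> //.
  move: c1; rewrite -(size_rot i) c_rot -q_last.
  by case: (c') => //= r c'' _; exact: mem_last.
move: c_cycle; rewrite -(rot_cycle i) c_rot /= rcons_path q_last => /andP[_].
have : q \in p |: M by apply: cM; rewrite -(mem_rot i) c_rot inE qc' orbT.
by rewrite !inE => /predU1P[qp|/Mp/negP//]; rewrite -qp qc' in pc'.
Qed.

Lemma acyclic1_ex_free M : acyclic1 M -> {in M &, injective snd} -> M != set0 ->
  exists2 p, p \in M & forall q, q \in M -> facing p q -> q = p.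
Proof.
move=> /acyclic1P acM snd_inj /set0Pn[p0 p0M]; apply: contrapT => no_free.
pose nxt p := odflt p [pick q | [&& q \in M, facing p q & q != p]].
have nxtP p : p \in M -> [/\ nxt p \in M, facing p (nxt p) & nxt p != p].
  move=> pM; rewrite /nxt; case: pickP => [q /and3P[]//|no_next].
  case: no_free; exists p => // q qM pq; apply/eqP.
  by have := no_next q; rewrite qM pq => /negbFE.
have iterM n : iter n nxt p0 \in M by elim: n => //= n /nxtP[].
have /trajectP[k k_lt iter_k] : looping nxt p0 (order nxt p0) by exact: looping_order.
pose c := orbit nxt (iter k nxt p0).
have c_cycle : fcycle nxt c.
  apply/(orbitPcycle 0 3); exists (order nxt p0 - k).-1.
  by rewrite prednK ?subn_gt0 // -iterD subnK // ltnW.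
have cM : {subset c <= M} by move=> p /trajectP[n _ ->]; rewrite -iterD.
have c_facing : cycle facing c.
  apply: (sub_in_cycle (P := mem M)) c_cycle; last exact/allP.
  by move=> p q pM _ /eqP <-; case: (nxtP p pM).
have uniq_c : uniq (map snd c).
  by rewrite map_inj_in_uniq ?orbit_uniq // => p q /cM pM /cM qM; exact: snd_inj.
apply/negP: c_facing; apply: acM => //; rewrite size_orbit.
move: c_cycle; rewrite /c /orbit; have := order_gt0 nxt (iter k nxt p0).
case: order => [|[|n]] //= _; rewrite andbT => /eqP fix_k.
by have [_ _ /eqP] := nxtP _ (iterM k).
Qed.

Lemma acyclic1_bd_neq0 M (S : {set {set V}}) :
  (forall p, p \in M -> facet p.1 p.2) -> {in M &, injective snd} -> acyclic1 M ->
  S \subset snd @: M -> S != set0 -> bd S != set0.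
Proof.
move=> M_facet snd_inj acM /subsetP SM /set0Pn[t tS].
pose MS := [set p in M | p.2 \in S].
have MS_M : MS \subset M by apply/subsetP => p; rewrite inE => /andP[].
have MSP u : u \in S -> exists2 q, q \in MS & u = q.2.
  by move=> uS; have /imsetP[q qM u_q] := SM u uS; exists q; rewrite // inE qM -u_q.
have [|||p pMS free] := @acyclic1_ex_free MS.
- exact: acyclic1_sub acM.
- by move=> p q /(subsetP MS_M) pM /(subsetP MS_M) qM; exact: snd_inj.
- by have [q qMS _] := MSP t tS; apply/set0Pn; exists q.
move: (pMS); rewrite inE => /andP[pM pS].
apply/set0Pn; exists p.1; rewrite inE.
have -> : [set t in S | facet p.1 t] = [set p.2]; last by rewrite cards1.
apply/setP => u; rewrite !inE; apply/andP/eqP => [[uS /andP[pu _]]|->].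
  by have [q qMS u_q] := MSP u uS; rewrite u_q (free q) // /facing -u_q.
by rewrite pS M_facet.
Qed.

Lemma collapses_matching K K' : is_simplicial_complex K -> collapses_to K K' ->
  exists M, [/\ facet_matching (K :\: K') M, acyclic1 M & forall j,
    #|simplices K j| = (#|[set p in M | #|p.1| == j.+1]| + #|[set p in M | #|p.2| == j.+1]|
                        + #|simplices K' j|)%N].
Proof.
move=> Kcx; elim=> [|K1 K2 KK1 [M [[M_pairs fst_inj snd_inj] acM M_card]]].
  exists set0; split=> [|c|j].
  - by split=> [p|p q|p q]; rewrite inE.
  - by case: c => -[|p c] [//= _ /andP[]]; rewrite inE.
  - by rewrite !(eq_card0 (A := mem [set p in set0 | _])) => // p; rewrite !inE.
case/elementary_collapseP => s [t [free ->]].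
have [sK1 tK1 st _] := free; have K1cx := collapses_complex Kcx KK1.
have M_out p : p \in M -> p.1 \notin K1 /\ p.2 \notin K1.
  by move=> /M_pairs[]; rewrite !inE => /andP[-> _] /andP[-> _].
have stM : (s, t) \notin M by apply: contraTN sK1 => /M_out[].
exists ((s, t) |: M); split; last first.
- by move=> j; rewrite !card_sep_setU1 //= M_card (card_simplices_remove j free); ring.
- apply: acyclic1_setU1 => // p pM /=; have [+ _] := M_out p pM; apply: contraNN => p1t.
  have [/setDP[p1K _] _ _] := M_pairs p pM.
  exact: complex_down K1cx tK1 p1t (complex_card_gt0 Kcx p1K).
have sub := subsetP (collapses_sub KK1).
split=> [p|p q|p q]; rewrite !inE.
- case/predU1P => [->|/M_pairs[]] /=; first by rewrite !eqxx !andbF !sub.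
  by rewrite !inE => /andP[/negPf-> ->] /andP[/negPf-> ->] ->; rewrite !andbF.
- case/predU1P => [->|pM] /predU1P[->|qM] //= => [s_q|p_s|]; last exact: fst_inj.
    by case: (M_out q qM); rewrite -s_q sK1.
  by case: (M_out p pM); rewrite p_s sK1.
- case/predU1P => [->|pM] /predU1P[->|qM] //= => [t_q|p_t|]; last exact: snd_inj.
    by case: (M_out q qM); rewrite -t_q tK1.
  by case: (M_out p pM); rewrite p_t tK1.
Qed.

Lemma collapsible_matching K : is_simplicial_complex K -> collapsible K ->
  exists M, [/\ matching K 1 M, acyclic1 M &
    (#|M| + #|simplices K 0| = #|simplices K 1|.+1)%N].
Proof.
move=> Kcx [v /(collapses_matching Kcx)[M [M_match acM M_card]]].
have [M_pairs _ _] := M_match.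
have card_vertex j : #|simplices [set [set v]] j| = (j == 0%N).
  by rewrite /simplices -sum1dep_card big_mkcondr big_set1 cards1 eqSS eq_sym; case: eqP.
exists [set p in M | #|p.1| == 2]; split.
- have [pairs fst_inj snd_inj] := facet_matching_dim 1 M_match; split=> // p /pairs[].
  by move=> /(subsetP (simplicesS _ (subsetDl _ _))) -> /(subsetP (simplicesS _ (subsetDl _ _))) ->.
- by apply: acyclic1_sub acM; apply/subsetP => p; rewrite inE => /andP[].
have no_vertex_upper : [set p in M | #|p.2| == 1%N] = set0.
  apply/setP => p; rewrite !inE; apply/andP => -[/M_pairs[/setDP[p1K _] _ /andP[_ /eqP ->]]].
  by rewrite eqSS -leqn0 leqNgt (complex_card_gt0 Kcx p1K).
have edge_upper : [set p in M | #|p.2| == 2] = [set p in M | #|p.1| == 1%N].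
  by apply/setP => p; rewrite !inE; apply/andb_id2l => /M_pairs[_ _ /andP[_ /eqP ->]].
by rewrite !M_card no_vertex_upper edge_upper !card_vertex cards0 /=; ring.
Qed.

End AcyclicMatchings.

Section CollapseAlongMatching.
Variable V : finType.
Implicit Types (K S : {set {set V}}) (s t : {set V}) (M : {set {set V} * {set V}}).

Lemma bd_top_free_face K d f : is_simplicial_complex K -> dim_le K d.+1 ->
  (#|[set t in K | facet f t]| <= 2)%N -> f \in bd (simplices K d.+1) -> #|f| = d.+1 ->
  exists t, free_face K f t.
Proof.
move=> Kcx Kd two_cofaces f_bd card_f.
have cofaces_top : [set t in simplices K d.+1 | facet f t] = [set t in K | facet f t].
  apply/setP => t; rewrite !inE -andbA; apply: andb_id2l => _; apply: andb_idl.
  by case/andP=> _ /eqP ->; rewrite card_f.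
have /cards1P[t t_def] : #|[set t in K | facet f t]| == 1%N.
  by move: two_cofaces f_bd; rewrite inE cofaces_top; case: #|_| => [|[|[|]]].
have := set11 t; rewrite -t_def inE => /andP[tK ft].
have fK : f \in simplices K d.
  by apply/simplicesP; split=> //; apply: complex_down Kcx tK _ _; [case/andP: ft | rewrite card_f].
exists t; apply: (free_face_top Kd) => // u /simplicesP[uK card_u] fu.
by apply/set1P; rewrite -t_def inE uK /facet fu card_u card_f eqxx.
Qed.

Lemma collapse_unmatched K j M :
  is_simplicial_complex K -> dim_le K j.+2 -> matching K j M -> acyclic1 M ->
  (forall f, f \in simplices K j.+1 -> #|[set t in K | facet f t]| <= 2)%N ->
  (forall S, S \subset simplices K j.+2 -> bd S = set0 -> S = set0) ->
  exists K', [/\ collapses_to K K', snd @: M \subset K', simplices K' j.+2 = set0,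
    #|simplices K j.+1| = (#|simplices K' j.+1| + #|simplices K j.+2|)%N &
    forall i, i != j.+1 -> i != j.+2 -> simplices K' i = simplices K i].
Proof.
move=> Kcx Kd M_match acM two_cofaces no_cycle; have [M_pairs _ snd_inj] := M_match.
apply: (@collapse_dimension _ (fun K1 => snd @: M \subset K1)); last first.
  by apply/subsetP => _ /imsetP[p /M_pairs[_ /simplicesP[pK _] _] ->].
move=> K1 KK1 MK1 S0; set S := simplices K1 j.+2 in S0.
have K1cx := collapses_complex Kcx KK1; have K1K := collapses_sub KK1.
(* The cycle [bd S] is nonempty, hence not carried by matched simplices. *)
have /subsetPn[f f_bd fM] : ~~ (bd S \subset snd @: M).
  apply/negP => bd_M; case/eqP: S0; apply: no_cycle; first exact: simplicesS.
  have /eqP := bdK S; apply: contraTeq => bdS0.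
  exact: acyclic1_bd_neq0 (fun p => matching_facet M_match) snd_inj acM bd_M bdS0.
have [t0 t0S ft0] : exists2 t0, t0 \in S & facet f t0.
  move: f_bd; rewrite inE => /odd_gt0; rewrite card_gt0 => /set0Pn[t0].
  by rewrite inE => /andP[]; exists t0.
have [[t0K1 card_t0] [f_t0 card_f]] := (simplicesP _ _ _ t0S, andP ft0).
move: card_f; rewrite card_t0 eqSS eq_sym => /eqP card_f.
have fK : f \in simplices K j.+1.
  apply/simplicesP; split=> //; apply: (subsetP K1K).
  by apply: complex_down K1cx t0K1 f_t0 _; rewrite card_f.
have [|t free] := bd_top_free_face K1cx (dim_leS K1K Kd) _ f_bd card_f.
  apply: leq_trans (two_cofaces f fK); apply: subset_leq_card.
  by apply/subsetP => u; rewrite !inE => /andP[/(subsetP K1K)-> ->].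
exists f, t; split=> //; apply/subsetP => g gM; rewrite !inE (subsetP MK1) // andbT.
have /imsetP[p /M_pairs[_ /simplicesP[_ card_g] _] g_def] := gM.
apply/andP; split; last by apply: contraNneq fM => <-.
apply: contra_eq_neq card_g; rewrite -g_def => ->.
by case: free => _ _ /andP[_ /eqP ->] _; rewrite card_f eqSS gtn_eqF.
Qed.

Lemma collapse_matched K j M :
  is_simplicial_complex K -> dim_le K j.+1 -> (forall p, p \in M -> facet p.1 p.2) ->
  {in M &, injective snd} -> acyclic1 M -> simplices K j.+1 \subset snd @: M ->
  exists K', [/\ collapses_to K K', simplices K' j.+1 = set0,
    #|simplices K j| = (#|simplices K' j| + #|simplices K j.+1|)%N &
    forall i, i != j -> i != j.+1 -> simplices K' i = simplices K i].
Proof.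
move=> Kcx Kd M_facet snd_inj acM topM.
have [|//|K' [KK' _ top0 card_j other]] := @collapse_dimension _ (fun=> True) j K;
  last by exists K'.
move=> K1 KK1 _ /set0Pn[t0 t0K1].
have K1cx := collapses_complex Kcx KK1; have K1K := collapses_sub KK1.
pose M1 := [set p in M | p.2 \in simplices K1 j.+1].
have M1_M : M1 \subset M by apply/subsetP => p; rewrite inE => /andP[].
have M1P t : t \in simplices K1 j.+1 -> exists2 p, p \in M1 & t = p.2.
  move=> tK1; have /imsetP[p pM t_p] := subsetP topM t (subsetP (simplicesS _ K1K) t tK1).
  by exists p; rewrite // inE pM -t_p.
have [|||p] := @acyclic1_ex_free _ M1.
- exact: acyclic1_sub acM.
- by move=> p q /(subsetP M1_M) pM /(subsetP M1_M) qM; exact: snd_inj.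
- by have [p pM1 _] := M1P t0 t0K1; apply/set0Pn; exists p.
rewrite inE => /andP[pM /simplicesP[p2K1 card_p2]] p_free.
have p12 := M_facet p pM; have [p1_p2 card_p1] := andP p12.
move: card_p1; rewrite card_p2 eqSS eq_sym => /eqP card_p1.
have p1K1 : p.1 \in simplices K1 j.
  by apply/simplicesP; split=> //; apply: complex_down K1cx p2K1 p1_p2 _; rewrite card_p1.
exists p.1, p.2; split=> //; apply: (free_face_top (dim_leS K1K Kd)) => // t tK1 pt.
by have [q qM1 t_q] := M1P t tK1; rewrite t_q (p_free q) // /facing -t_q.
Qed.

Lemma sum_cofaces K j : is_simplicial_complex K ->
  (\sum_(s in simplices K j) #|[set t in simplices K j.+1 | facet s t]| =
   j.+2 * #|simplices K j.+1|)%N.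
Proof.
move=> Kcx; under eq_bigr => s _ do rewrite -sum1dep_card.
rewrite (exchange_big_dep (mem (simplices K j.+1))) /=; last by move=> s t _ /andP[].
rewrite mulnC -sum_nat_const; apply: eq_bigr => t /simplicesP[tK card_t].
rewrite -card_t -card_facets sum1dep_card; apply: eq_card => s; rewrite !inE tK card_t eqxx /=.
apply: andb_idl => st; have card_s : #|s| = j.+1.
  by case/andP: st => _; rewrite card_t eqSS => /eqP.
rewrite card_s eqxx andbT; apply: complex_down Kcx tK _ _; first by case/andP: st.
by rewrite card_s.
Qed.

Lemma edge_connected_cofaces K s : edge_connected K -> s \in simplices K 0 ->
  (1 < #|simplices K 0|)%N -> (0 < #|[set e in simplices K 1 | facet s e]|)%N.
Proof.
move=> /edge_connectedP K_conn sK many; rewrite lt0n cards_eq0; apply/negP => /eqP isolated.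
have /simplices0P[v s_def vK] := sK.
have : (0 < #|simplices K 0 :\ s|)%N by move: many; rewrite (cardsD1 s) sK.
rewrite card_gt0 => /set0Pn[s']; rewrite 3!inE => /andP[s's s'K].
have /simplices0P[w s'_def wK] : s' \in simplices K 0 by rewrite inE.
have v_closed : closed (edge_rel K) (pred1 v).
  move=> x y xyK; rewrite !inE; have [->//|xy] := eqVneq x y.
  have xyE : [set x; y] \in simplices K 1 by apply/simplicesP; rewrite cards2 xy.
  have /negbT : [set x; y] \in [set e in simplices K 1 | facet s e] = false by rewrite isolated inE.
  rewrite inE xyE s_def /facet cards1 cards2 xy sub1set !inE andbT !(eq_sym v).
  by case/norP => /negPf-> /negPf->.
have := K_conn _ v_closed v w vK wK; rewrite !inE eqxx => /esym/eqP vw.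
by rewrite s'_def s_def vw eqxx in s's.
Qed.

Lemma edge_connected_ex_leaf K : is_simplicial_complex K -> dim_le K 1 -> edge_connected K ->
  (#|simplices K 1| < #|simplices K 0|)%N -> simplices K 1 != set0 ->
  exists s e, free_face K s e /\ #|s| = 1%N.
Proof.
move=> Kcx Kd K_conn few edges.
have many : (1 < #|simplices K 0|)%N by apply: leq_ltn_trans few; rewrite card_gt0.
have [s sK deg_s] : exists2 s, s \in simplices K 0 &
    (#|[set e in simplices K 1 | facet s e]| < 2)%N.
  apply/exists_inP; apply: contraLR few => /exists_inPn deg_ge2.
  rewrite -leqNgt -(leq_pmul2l (ltn0Sn 1)) -(sum_cofaces 0 Kcx) mulnC -sum_nat_const.
  by apply: leq_sum => s /deg_ge2; rewrite -leqNgt.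
have /cards1P[e e_def] : #|[set e in simplices K 1 | facet s e]| == 1%N.
  by rewrite eqn_leq -ltnS deg_s edge_connected_cofaces.
have := set11 e; rewrite -e_def inE => /andP[/simplicesP[eK _] se].
have /simplicesP[_ card_s] := sK.
exists s, e; split=> //; apply: (free_face_top Kd) => // u uK su; apply/set1P.
by rewrite -e_def inE uK /facet su card_s; case/simplicesP: uK => _ ->.
Qed.

Lemma collapsible_tree K : is_simplicial_complex K -> dim_le K 1 -> edge_connected K ->
  #|simplices K 0| = #|simplices K 1|.+1 -> collapsible K.
Proof.
move=> Kcx Kd K_conn card0.
have [||K' [KK' few K'1 card0' _]] :=
  @collapse_dimension _ (fun K1 => #|simplices K1 1| < #|simplices K1 0|)%N 0 K.
- move=> K1 KK1 few edges; have K1cx := collapses_complex Kcx KK1.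
  have K1d := dim_leS (collapses_sub KK1) Kd.
  have K1_conn := collapses_edge_connected Kcx KK1 K_conn.
  have [s [e [free card_s]]] := edge_connected_ex_leaf K1cx K1d K1_conn few edges.
  exists s, e; split=> //; have [_ _ /andP[_ /eqP card_e] _] := free.
  by move: few; rewrite !(card_simplices_remove _ free) card_e card_s.
- by rewrite card0.
have /cards1P[s s_def] : #|simplices K' 0| == 1%N by move: card0'; rewrite card0; lia.
have /simplices0P[v s_v vK'] : s \in simplices K' 0 by rewrite s_def set11.
have K'cx := collapses_complex Kcx KK'.
have K'd : dim_le K' 0 by apply: dim_le_pred (dim_leS (collapses_sub KK') Kd) K'1.
exists v; rewrite -(_ : K' = [set [set v]]) //; apply/setP => t.
rewrite -s_v -s_def inE; apply/esym/andb_idr => tK'.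
by rewrite eqn_leq K'd // (complex_card_gt0 K'cx).
Qed.

Lemma complete_matching_collapsible K M : is_simplicial_complex K -> dim_le K 3 ->
  edge_connected K ->
  (forall f, f \in simplices K 2 -> #|[set t in K | facet f t]| <= 2)%N ->
  (forall S, S \subset simplices K 3 -> bd S = set0 -> S = set0) ->
  (#|simplices K 2| <= #|M| + #|simplices K 3|)%N ->
  (#|M| + #|simplices K 0| = #|simplices K 1|.+1)%N ->
  matching K 1 M -> acyclic1 M -> collapsible K.
Proof.
move=> Kcx Kd K_conn two_cofaces no_cycle triangles edges M_match acM.
have [_ _ snd_inj] := M_match.
have [K1 [KK1 MK1 K1_3 card2 other1]] := collapse_unmatched Kcx Kd M_match acM two_cofaces no_cycle.
have K1cx := collapses_complex Kcx KK1.
have K1d : dim_le K1 2 by apply: dim_le_pred (dim_leS (collapses_sub KK1) Kd) K1_3.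
have M_K1 : snd @: M = simplices K1 2.
  apply/eqP; rewrite eqEcard card_in_imset //; apply/andP; split; last first.
    by rewrite card2 leq_add2r in triangles.
  apply/subsetP => f fM; apply/simplicesP; split; first exact: (subsetP MK1).
  by have /imsetP[p pM ->] := fM; case: M_match => /(_ p pM)[_ /simplicesP[]].
have [|K2 [K1K2 K2_2 card1 other2]] :=
  collapse_matched K1cx K1d (fun p => matching_facet M_match) snd_inj acM _; first by rewrite M_K1.
have KK2 := collapses_trans KK1 K1K2; have K2cx := collapses_complex Kcx KK2.
have K2d : dim_le K2 1 by apply: dim_le_pred (dim_leS (collapses_sub K1K2) K1d) K2_2.
have [|v K2v] := collapsible_tree K2cx K2d (collapses_edge_connected Kcx KK2 K_conn).
  move: card1 edges; rewrite -M_K1 card_in_imset // (other2 0%N) // !other1 // => ->.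
  by rewrite addnC -addSn => /addIn.
by exists v; exact: collapses_trans K2v.
Qed.

End CollapseAlongMatching.

(** * Ranks of incidence matrices *)

Lemma mxrank_mxsub (F : fieldType) m n m' n' (f : 'I_m' -> 'I_m) (g : 'I_n' -> 'I_n)
  (A : 'M[F]_(m, n)) : (\rank (mxsub f g A) <= \rank A)%N.
Proof.
have rank_rowsub p q q' (h : 'I_q' -> 'I_q) (B : 'M[F]_(q, p)) : (\rank (rowsub h B) <= \rank B)%N.
  exact: mxrankS (rowsub_sub _ _).
have -> : mxsub f g A = (rowsub g (rowsub f A)^T)^T by apply/matrixP => i j; rewrite !mxE.
by rewrite mxrank_tr (leq_trans (rank_rowsub _ _ _ _ _)) // mxrank_tr rank_rowsub.
Qed.

(* A maximal minor that is nonzero in [F] is a nonzero integer. *)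
Lemma mxrank_intr_le (F : fieldType) (R : numFieldType) m n (A : 'M[int]_(m, n)) :
  (\rank (map_mx (intr : int -> F) A) <= \rank (map_mx (intr : int -> R) A))%N.
Proof.
set B := map_mx (intr : int -> F) A; pose f := maxrankfun B.
have full : row_full (rowsub f B)^T.
  by rewrite /row_full mxrank_tr; have := maxrowsub_free B; rewrite /row_free.
pose g := fullrankfun full.
have unitB : mxsub f g B \in unitmx.
  have -> : mxsub f g B = (rowsub g (rowsub f B)^T)^T by apply/matrixP => i j; rewrite !mxE.
  by rewrite unitmx_tr fullrowsub_unit.
have detA : \det (mxsub f g A) != 0.
  apply: contraTneq unitB => detA0.
  by rewrite unitmxE -map_mxsub det_map_mx detA0 rmorph0 unitr0.
have unitA : mxsub f g (map_mx (intr : int -> R) A) \in unitmx.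
  by rewrite unitmxE -map_mxsub det_map_mx unitfE intr_eq0.
by rewrite -{1}(mxrank_unit unitA) mxrank_mxsub.
Qed.

Lemma row_enum_valP (U : nmodType) (T : finType) (A : {set T}) (x : 'rV[U]_#|A|) :
  exists2 c : T -> U, forall v, v \notin A -> c v = 0 & x = \row_i c (enum_val i).
Proof.
exists (fun v => \sum_(i | enum_val i == v) x 0 i) => [v vA|].
  by rewrite big_pred0 // => i; apply: contraNF vA => /eqP <-; exact: enum_valP.
apply/rowP => i; rewrite mxE (big_pred1 i) // => j /=.
by rewrite (inj_eq enum_val_inj).
Qed.

Section Incidence.
Variables (V : finType) (or : {set V} -> bool).
Implicit Types (s t f : {set V}) (u v : V).

Definition position f v := #|[set u in f | (enum_rank u < enum_rank v)%N]|.

Lemma position_setD1 f u v : u \in f ->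
  position f v = ((enum_rank u < enum_rank v) + position (f :\ u) v)%N.
Proof.
move=> uf; rewrite /position -[in LHS](setD1K uf) -sum1dep_card big_mkcondr.
rewrite big_setU1 ?setD11 //= -big_mkcondr sum1dep_card.
by case: ltnP.
Qed.

Lemma incidence_setD1 (R : nzRingType) f v : v \in f ->
  incidence R or (f :\ v) f = (-1) ^+ (or (f :\ v) + or f + position f v).
Proof.
move=> vf; rewrite /incidence subD1set /ref_incidence_exp.
by rewrite setDDr setDv set0U (setIidPr _) ?sub1set // big_set1.
Qed.

Lemma incidence_F2 s t : incidence 'F_2 or s t = (s \subset t)%:R.
Proof.
rewrite /incidence; case: ifP => // _.
by have -> : -1 = 1 :> 'F_2; [apply/val_inj | rewrite expr1n].
Qed.

Lemma incidence_intr (R : nzRingType) s t : incidence R or s t = (incidence int or s t)%:~R.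
Proof.
rewrite /incidence; case: ifP => _; last by rewrite rmorph0.
by rewrite rmorphXn rmorphN1.
Qed.

Lemma incidence_incidence (R : nzRingType) f u v : u \in f -> v \in f -> u != v ->
  incidence R or (f :\ u) f * incidence R or (f :\ u :\ v) (f :\ u) +
  incidence R or (f :\ v) f * incidence R or (f :\ u :\ v) (f :\ v) = 0.
Proof.
move=> uf vf uv; rewrite {2}(_ : f :\ u :\ v = f :\ v :\ u); last by rewrite !setDDl setUC.
rewrite !incidence_setD1 ?(position_setD1 u vf) ?(position_setD1 v uf) ?inE ?uv 1?eq_sym ?uv //.
have -> : f :\ v :\ u = f :\ u :\ v by rewrite !setDDl setUC.
have vu : (enum_rank v < enum_rank u)%N = ~~ (enum_rank u < enum_rank v)%N.
  by rewrite ltn_neqAle -leqNgt (inj_eq val_inj) (inj_eq enum_rank_inj) eq_sym uv.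
rewrite -!exprD -(signr_odd _ (_ + _)) -[X in _ + X]signr_odd !oddD !oddb vu.
case: (or f); case: (or (f :\ u)); case: (or (f :\ v)); case: (or _);
case: (_ < _)%N; case: (odd (position _ v)); case: (odd (position _ u));
by rewrite ?addrN ?addNr.
Qed.

End Incidence.

Section IncidenceMatrices.
Variables (V : finType) (K : {set {set V}}) (or : {set V} -> bool).
Hypothesis Kcx : is_simplicial_complex K.

Definition incidence_matrix (R : nzRingType) j : 'M[R]_(#|simplices K j.+1|, #|simplices K j|) :=
  \matrix_(i, l) incidence R or (enum_val l) (enum_val i).

Lemma sum_simplices_facets (U : nmodType) j (F : {set V} -> U) t : t \in simplices K j.+1 ->
  (forall s : {set V}, ~~ (s \subset t) -> F s = 0) ->
  \sum_(s in simplices K j) F s = \sum_(v in t) F (t :\ v).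
Proof.
move=> /simplicesP[tK card_t] F0; rewrite -sum_facets.
rewrite [LHS](bigID (fun s : {set V} => s \subset t)) /= [X in _ + X]big1 ?addr0 => [|s /andP[_]];
  last exact: F0.
 apply: eq_bigl => s; rewrite inE /facet card_t eqSS eq_sym andbC.
apply: andb_id2l => st; apply: andb_idl => /eqP card_s.
by apply: complex_down Kcx tK st _; rewrite -card_s.
Qed.

Lemma incidence_matrix_mul0 (R : nzRingType) j :
  incidence_matrix R j.+1 *m incidence_matrix R j = 0.
Proof.
apply/matrixP => i l; rewrite !mxE; under eq_bigr do rewrite !mxE.
have fK := enum_valP i; have /simplicesP[_ card_g] := enum_valP l.
move: (enum_val i) (enum_val l) fK card_g => f g fK card_g; have /simplicesP[_ card_f] := fK.
rewrite -(big_enum_val (fun e => incidence R or e f * incidence R or g e)) /=.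
rewrite (sum_simplices_facets fK) => [|e /negPf ef]; last by rewrite {1}/incidence ef mul0r.
have [gf|gf] := boolP (g \subset f); last first.
  apply: big1 => v _; rewrite [X in _ * X]/incidence ifF ?mulr0 //.
  by apply: contraNF gf => /subset_trans; apply; exact: subD1set.
have /cards2P[u [v [uv fg]]] : #|f :\: g| == 2%N by rewrite cardsDS // card_f card_g -addn2 addKn.
have g_def : g = f :\ u :\ v by rewrite setDDl -fg setDDr setDv set0U (setIidPr gf).
have [uf vf] : u \in f /\ v \in f.
  by have := (set21 u v, set22 u v); rewrite -fg => -[/setDP[-> _] /setDP[-> _]].
rewrite (bigD1 u) //= (bigD1 v) ?vf 1?eq_sym //= big1 => [|w /andP[/andP[wf wu] wv]].
  by rewrite addr0 g_def incidence_incidence.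
rewrite [X in _ * X]/incidence ifF ?mulr0 //; apply/negbTE/subsetPn.
by exists w; rewrite ?g_def !inE ?eqxx // wu wv.
Qed.

Lemma face_edge_matrixE (R : nzRingType) : face_edge_matrix R K or = incidence_matrix R 1.
Proof. by []. Qed.

Lemma row_mul_incidence (c : {set V} -> 'F_2) j :
  (\row_i c (enum_val i)) *m (incidence_matrix 'F_2 j)^T = \row_i scobd c (enum_val i).
Proof.
apply/rowP => i; rewrite !mxE; under eq_bigr do rewrite !mxE.
rewrite -(big_enum_val (fun s => c s * incidence 'F_2 or s (enum_val i))) /=.
rewrite (sum_simplices_facets (enum_valP i)) => [|s /negPf si].
  by apply: eq_bigr => v _; rewrite incidence_F2 subD1set mulr1.
by rewrite /incidence si mulr0.
Qed.

Lemma exact_at_rank j : exact_at K j.+2 ->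
  (#|simplices K j.+1| <=
   \rank (incidence_matrix 'F_2 j) + \rank (incidence_matrix 'F_2 j.+1))%N.
Proof.
move=> ex; rewrite -[X in (_ <= X + _)%N]mxrank_tr -[X in (_ <= _ + X)%N]mxrank_tr.
rewrite addnC -leq_subLR -mxrank_ker; apply/mxrankS/rV_subP => x /sub_kermxP.
have [c _ ->] := row_enum_valP x; rewrite row_mul_incidence => /rowP c_cocycle.
have [t tK card_t|b b_c] := ex c.
  have tS : t \in simplices K j.+2 by apply/simplicesP.
  by have := c_cocycle (enum_rank_in tS t); rewrite !mxE enum_rankK_in.
apply/submxP; exists (\row_l b (enum_val l)); rewrite row_mul_incidence.
by apply/rowP => i; rewrite !mxE b_c //; case/simplicesP: (enum_valP i).
Qed.

Lemma exact_at1_edge_connected : exact_at K 1 -> edge_connected K.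
Proof.
move=> ex; apply/edge_connectedP => P P_closed u v uK vK.
pose c (s : {set V}) : 'F_2 := [exists w in s, w \in P]%:R.
have c1 w : c [set w] = (w \in P)%:R.
  congr (nat_of_bool _)%:R; apply/exists_inP/idP => [[x /set1P->//]|wP].
  by exists w; rewrite ?set11.
have [t tK /eqP/cards2P[x [y [xy t_def]]]|b b_c] := ex c.
  by rewrite t_def scobd_set2 // !c1 (P_closed x y) ?addrr_F2 // /edge_rel /= -t_def.
have c_const w : [set w] \in K -> (w \in P)%:R = b set0.
  by move=> wK; rewrite -c1 -b_c ?cards1 // /scobd big_set1 setDv.
have := c_const u uK; rewrite -(c_const v vK) => /eqP.
by case: (u \in P); case: (v \in P); rewrite // ?oner_eq0 // eq_sym oner_eq0.
Qed.

Lemma kermx_incidence0 : edge_connected K ->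
  (kermx (incidence_matrix 'F_2 0)^T :=: (const_mx 1 : 'rV_#|simplices K 0|))%MS.
Proof.
move=> /edge_connectedP K_conn; apply/eqmxP/andP; split; last first.
  pose ones (_ : {set V}) : 'F_2 := 1; apply/sub_kermxP.
  have -> : const_mx 1 = \row_i ones (enum_val i) :> 'rV_#|simplices K 0|.
    by apply/rowP => i; rewrite !mxE.
  rewrite row_mul_incidence; apply/rowP => i; rewrite !mxE /scobd sumr_const.
  by have /simplicesP[_ ->] := enum_valP i; rewrite mulr2n addrr_F2.
apply/rV_subP => x /sub_kermxP; have [c _ ->] := row_enum_valP x.
rewrite row_mul_incidence => /rowP c_cocycle.
have c_edge u v : [set u; v] \in K -> c [set u] = c [set v].
  move=> uvK; have [->//|uv] := eqVneq u v.
  have uvS : [set u; v] \in simplices K 1 by apply/simplicesP; rewrite cards2 uv.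
  have := c_cocycle (enum_rank_in uvS [set u; v]); rewrite !mxE enum_rankK_in // scobd_set2 //.
  by move/eqP; rewrite addr_eq0 oppr_pchar2 ?pchar_Fp // => /eqP.
have [i0 _|K_empty] := pickP (fun i : 'I_#|simplices K 0| => true); last first.
  by rewrite (_ : (\row_i _) = 0) ?sub0mx //; apply/rowP => i; have := K_empty i.
have /simplices0P[v0 v0_def v0K] := enum_valP i0.
apply/sub_rVP; exists (c [set v0]); apply/rowP => i; rewrite !mxE mulr1.
have /simplices0P[v -> vK] := enum_valP i.
have P_closed : closed (edge_rel K) [pred w | c [set w] == c [set v0]].
  by move=> u w uwK; rewrite !inE (c_edge u w).
by have := K_conn _ P_closed v v0 vK v0K; rewrite !inE eqxx => /eqP.
Qed.

Lemma rank_incidence0 : edge_connected K -> (0 < #|simplices K 0|)%N ->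
  (\rank (incidence_matrix 'F_2 0)).+1 = #|simplices K 0|.
Proof.
move=> K_conn card0; have := mxrank_ker (incidence_matrix 'F_2 0)^T.
rewrite kermx_incidence0 // rank_rV mxrank_tr.
have -> : const_mx 1 != 0 :> 'rV['F_2]_#|simplices K 0|.
  by apply/eqP => /rowP/(_ (Ordinal card0))/eqP; rewrite !mxE oner_eq0.
by have := rank_leq_col (incidence_matrix 'F_2 0); lia.
Qed.

Section RealRanks.
Variable R : numFieldType.

Lemma rank_incidence_F2_le j :
  (\rank (incidence_matrix 'F_2 j) <= \rank (incidence_matrix R j))%N.
Proof.
have intrE (S : nzRingType) : incidence_matrix S j = map_mx intr (incidence_matrix int j).
  by apply/matrixP => i l; rewrite !mxE incidence_intr.
by rewrite (intrE 'F_2) (intrE R) mxrank_intr_le.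
Qed.

Lemma exact_at_card_le j : exact_at K j.+2 ->
  (#|simplices K j.+1| <= \rank (incidence_matrix R j) + #|simplices K j.+2|)%N.
Proof.
move=> /exact_at_rank ranks; apply: leq_trans ranks _.
by rewrite leq_add ?rank_leq_row ?rank_incidence_F2_le.
Qed.

Lemma rank_face_edge_matrix : edge_connected K -> exact_at K 2 -> (0 < #|simplices K 0|)%N ->
  (\rank (face_edge_matrix R K or) + #|simplices K 0| = #|simplices K 1|.+1)%N.
Proof.
move=> K_conn /exact_at_rank rank01 card0; rewrite face_edge_matrixE.
have rank0 := rank_incidence0 K_conn card0.
have rank0R := rank_incidence_F2_le 0; have rank1R := rank_incidence_F2_le 1.
have rank_sum := mulmx0_rank_max (incidence_matrix_mul0 R 0).
lia.
Qed.

End RealRanks.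
End IncidenceMatrices.

(* Imported only here: its set notations would capture those of [finset] above. *)
From mathcomp Require Import all_classical all_reals all_analysis.
Import numFieldNormedType.Exports.
Local Open Scope classical_set_scope.
Local Open Scope ring_scope.

(** * Cochains on small tuples of points *)

Section SmallCochains.
Variables (R : realFieldType) (W : normedModType R).
Implicit Types (xs ys : seq W) (A B : set W) (a b : seq W -> 'F_2).

Definition small (d : R) xs := forall x y, x \in xs -> y \in xs -> `|x - y| <= d.

(* Equality of germs at the diagonal, as for Alexander-Spanier cochains. *)
Definition eq_small A n d a b :=
  forall xs, size xs = n -> (forall x, x \in xs -> A x) -> small d xs -> a xs = b xs.

Definition small_acyclic A n := forall a e, 0 < e -> eq_small A n.+1 e (cobd a) (fun=> 0) ->
  exists b, exists2 d, 0 < d & eq_small A n d (cobd b) a.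

Definition bary xs : W := (size xs)%:R^-1 *: \sum_(x <- xs) x.

Definition bary_closed A :=
  forall xs, (0 < size xs)%N -> (forall x, x \in xs -> A x) -> A (bary xs).

Lemma eq_small_sub A A' n d d' a b :
  A' `<=` A -> d' <= d -> eq_small A n d a b -> eq_small A' n d' a b.
Proof.
move=> A'A d'd eq_ab xs size_xs xsA' xs_small; apply: eq_ab => // [x /xsA'/A'A //|x y x_xs y_xs].
exact: le_trans (xs_small x y x_xs y_xs) d'd.
Qed.

Lemma bary_sub xs z : (0 < size xs)%N ->
  bary xs - z = (size xs)%:R^-1 *: \sum_(x <- xs) (x - z).
Proof.
move=> size_gt0; rewrite sumrB scalerBr; congr (_ - _).
rewrite big_const_seq count_predT iter_addr_0 -(scaler_nat _ z) scalerA mulVf ?scale1r //.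
by rewrite pnatr_eq0 -lt0n.
Qed.

Lemma ler_norm_sum_const xs z (d : R) : (forall x, x \in xs -> `|x - z| <= d) ->
  `|\sum_(x <- xs) (x - z)| <= d *+ size xs.
Proof.
move=> xs_d; rewrite (le_trans (ler_norm_sum _ _ _)) //.
rewrite -iter_addr_0 -count_predT -big_const_seq !big_seq.
exact: ler_sum.
Qed.

Lemma bary_closed_ball z d : bary_closed [set y | `|z - y| <= d].
Proof.
move=> xs size_gt0 xs_d; rewrite /= distrC bary_sub // normrZ ger0_norm ?invr_ge0 ?ler0n //.
rewrite ler_pdivrMl ?ltr0n // mulrC mulr_natr; apply: ler_norm_sum_const => x /xs_d.
by rewrite /= distrC.
Qed.

Lemma bary_closedI A B : bary_closed A -> bary_closed B -> bary_closed (A `&` B).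
Proof. by move=> cA cB xs n0 xsAB; split; [apply: cA|apply: cB] => // x /xsAB[]. Qed.

Lemma bary_dist n xs (d : R) x : (size xs <= n)%N -> small d xs -> x \in xs ->
  `|bary xs - x| <= (1 - n%:R^-1) * d.
Proof.
move=> size_le xs_small x_xs; have size_gt0 : (0 < size xs)%N by case: (xs) x_xs.
have d0 : 0 <= d by apply: le_trans (xs_small x x x_xs x_xs); exact: normr_ge0.
apply: (@le_trans _ _ ((1 - (size xs)%:R^-1) * d)); last first.
  by rewrite ler_wpM2r // lerB // lef_pV2 ?posrE ?ltr0n ?ler_nat // (leq_trans size_gt0).
rewrite bary_sub // normrZ ger0_norm ?invr_ge0 ?ler0n // ler_pdivrMl ?ltr0n //.
rewrite mulrA mulrBr mulr1 divff ?pnatr_eq0 -?lt0n //.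
rewrite -[X in X%:R](prednK size_gt0) -natr1 addrK mulr_natl.
rewrite (perm_big _ (perm_to_rem x_xs)) /= big_cons subrr add0r -(size_rem x_xs).
by apply: ler_norm_sum_const => y /mem_rem y_xs; exact: xs_small.
Qed.

Lemma eq_small_sdn A n k d b b' : (k <= n)%N -> bary_closed A ->
  eq_small A k ((1 - n%:R^-1) * d) b b' -> eq_small A k d (sdn bary k b) (sdn bary k b').
Proof.
elim: k A b b' => [|k IH] A b b' kn cA eq_b xs size_xs xsA xs_small.
  by apply: eq_b; case: xs size_xs {xsA xs_small}.
have bary_near x : x \in xs -> `|bary xs - x| <= (1 - n%:R^-1) * d.
  by apply: bary_dist => //; rewrite size_xs.
apply: eq_in_cobd => zs; rewrite size_xs => size_zs zs_xs.
pose near := [set y | `|bary xs - y| <= (1 - n%:R^-1) * d].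
apply: (IH (A `&` near)) => //; first exact: ltnW.
- by apply: bary_closedI; last exact: bary_closed_ball.
- move=> ys size_ys ysA ys_small; apply: eq_b; first by rewrite /= size_ys.
    move=> y; rewrite inE => /predU1P[->|/ysA[]//].
    by apply: cA; rewrite ?size_xs.
  have [x x_xs] : exists x, x \in xs.
    by case: (xs) size_xs => [//|x ? _]; exists x; exact: mem_head.
  move=> x1 x2; rewrite !inE => /predU1P[->|x1_ys] /predU1P[->|x2_ys].
  + by rewrite subrr normr0; apply: le_trans (bary_near x x_xs); exact: normr_ge0.
  + by case: (ysA _ x2_ys).
  + by rewrite distrC; case: (ysA _ x1_ys).
  + exact: ys_small.
- by move=> x /zs_xs x_xs; split; [exact: xsA | exact: bary_near].
- by move=> x y /zs_xs x_xs /zs_xs y_xs; exact: xs_small.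
Qed.

Lemma eq_small_iter_sd N A n d b b' : bary_closed A ->
  eq_small A n ((1 - n%:R^-1) ^+ N * d) b b' ->
  eq_small A n d (iter N (sd bary) b) (iter N (sd bary) b').
Proof.
move=> cA; elim: N d => [|N IH] d eq_b; first by rewrite expr0 mul1r in eq_b.
move=> xs size_xs; rewrite /= /sd size_xs; apply: (eq_small_sdn (leqnn n) cA) xs size_xs.
by apply: IH; rewrite mulrA -exprSr.
Qed.

End SmallCochains.

Lemma eq_small_comp (R : realFieldType) (W1 W2 : normedModType R) (A : set W1) (B : set W2)
    (f : W1 -> W2) n (d e : R) a b :
  (forall x, A x -> B (f x)) ->
  (forall x y, A x -> A y -> `|x - y| <= d -> `|f x - f y| <= e) ->
  eq_small B n e a b -> eq_small A n d (fun xs => a (map f xs)) (fun xs => b (map f xs)).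
Proof.
move=> fAB f_unif eq_ab xs size_xs xsA xs_small; apply: eq_ab; first by rewrite size_map.
  by move=> _ /mapP[x /xsA xA ->]; exact: fAB.
move=> _ _ /mapP[x x_xs ->] /mapP[y y_xs ->].
by apply: f_unif; [exact: xsA | exact: xsA | exact: xs_small].
Qed.

Section StarShaped.
Variables (R : realType) (W : normedModType R) (A : set W) (M : R).
Hypothesis A0 : A 0.
Hypothesis A_star : forall x t, A x -> 0 <= t <= 1 -> A (t *: x).
Hypothesis A_bounded : forall x, A x -> `|x| <= M.

Lemma cobd_prism_small n (e : R) (a : seq W -> 'F_2) (f g : W -> W) xs :
  eq_small A n.+1 e (cobd a) (fun=> 0) -> size xs = n ->
  (forall x, x \in map f xs ++ map g xs -> A x) -> small e (map f xs ++ map g xs) ->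
  cobd (prism f g a) xs = a (map f xs) + a (map g xs).
Proof.
move=> a_cocycle size_xs fgA fg_small; rewrite -cobd_prism [X in _ = _ + X]prism_eq0 ?addr0 //.
move=> ys; rewrite size_xs => size_ys ys_fg; apply: a_cocycle => // [y /ys_fg/fgA //|x y].
by move=> /ys_fg x_fg /ys_fg; exact: fg_small.
Qed.

Lemma norm_scaleB_le (s t : R) (x y : W) : 0 <= s <= 1 ->
  `|s *: x - t *: y| <= `|x - y| + `|s - t| * `|y|.
Proof.
case/andP=> s0 s1; apply: le_trans (ler_distD (s *: y) _ _) _.
by rewrite -scalerBr -scalerBl !normrZ (ger0_norm s0) lerD // ler_piMl.
Qed.

Lemma cobd_prism_scale n (e s t : R) a xs :
  0 < e -> eq_small A n.+1 e (cobd a) (fun=> 0) ->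
  size xs = n -> (forall x, x \in xs -> A x) -> small (e / 2) xs ->
  0 <= s <= 1 -> 0 <= t <= 1 -> `|s - t| * M <= e / 2 ->
  cobd (prism ( *:%R s) ( *:%R t) a) xs = a (map ( *:%R s) xs) + a (map ( *:%R t) xs).
Proof.
move=> e0 a_cocycle size_xs xsA xs_small s01 t01 st.
have scaled y : y \in map ( *:%R s) xs ++ map ( *:%R t) xs ->
    exists2 r, r \in [:: s; t] & exists2 x, x \in xs & y = r *: x.
  rewrite mem_cat => /orP[]/mapP[x x_xs ->]; [exists s|exists t]; try by exists x.
    by rewrite inE eqxx.
  by rewrite !inE eqxx orbT.
have st01 r : r \in [:: s; t] -> 0 <= r <= 1 by rewrite !inE => /orP[]/eqP->.
apply: cobd_prism_small a_cocycle size_xs _ _ => [y|].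
  by move=> /scaled[r /st01 r01 [x /xsA xA ->]]; exact: A_star.
move=> _ _ /scaled[r r_st [x x_xs ->]] /scaled[r' r'_st [y y_xs ->]].
apply: le_trans (norm_scaleB_le _ _ _ (st01 r r_st)) _; rewrite (splitr e) lerD ?xs_small //.
apply: (@le_trans _ _ (`|r - r'| * M)); first by rewrite ler_wpM2l ?(A_bounded (xsA y y_xs)).
have e20 : 0 <= e / 2 by rewrite divr_ge0 ?ltW.
by move: r_st r'_st; rewrite !inE => /orP[]/eqP-> /orP[]/eqP->;
  rewrite ?subrr ?normr0 ?mul0r // distrC.
Qed.

Lemma telescope_F2 (u : nat -> 'F_2) N : \sum_(0 <= j < N) (u j + u j.+1) = u 0%N + u N.
Proof.
elim: N => [|N IH]; first by rewrite big_nil addrr_F2.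
by rewrite big_nat_recr //= IH -addrA [X in _ + X]addrA addrr_F2 add0r.
Qed.

(* The homotopy from the constant [0] to the identity is cut into [N] steps. *)
Lemma small_acyclic_star n : small_acyclic A n.
Proof.
move=> a e e0 a_cocycle; have e20 : 0 < e / 2 by rewrite divr_gt0.
pose N := (Num.truncn (M / (e / 2))).+1.
have MN : N%:R^-1 * M <= e / 2.
  by rewrite ler_pdivrMl ?ltr0n // -ler_pdivrMr // ltW // truncnS_gt.
pose f j : W -> W := *:%R (j%:R / N%:R : R); pose a0 := a (nseq n 0).
exists (fun ys => \sum_(0 <= j < N) prism (f j) (f j.+1) a ys + a0), (e / 2) => //.
move=> xs size_xs xsA xs_small.
have frac j : (j <= N)%N -> 0 <= (j%:R / N%:R : R) <= 1.
  by move=> jN; rewrite divr_ge0 //= ler_pdivrMr ?ltr0n // mul1r ler_nat.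
have step j : (0 <= j < N)%N ->
    cobd (prism (f j) (f j.+1) a) xs = a (map (f j) xs) + a (map (f j.+1) xs).
  move=> /= jN; apply: cobd_prism_scale a_cocycle _ _ _ _ _ _ => //; rewrite ?frac // ?(ltnW jN) //.
  by rewrite distrC -mulrBl -natr1 addrAC subrr add0r mul1r ger0_norm ?invr_ge0.
have a0_n : a0 *+ n = a0.
  have /eqP : cobd a (nseq n.+1 0) = 0.
    apply: a_cocycle; first by rewrite size_nseq.
      by move=> x /nseqP[->].
    by move=> x y /nseqP[-> _] /nseqP[-> _]; rewrite subrr normr0 ltW.
  by rewrite cobd_nseq mulrS addr_eq0 oppr_pchar2 ?pchar_Fp // => /eqP.
rewrite cobdD cobd_sum cobd_const size_xs a0_n (eq_big_nat _ _ step) telescope_F2.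
have -> : map (f N) xs = xs.
  by rewrite map_id_in // => x _; rewrite /f divff ?scale1r ?pnatr_eq0.
have -> : map (f 0%N) xs = nseq n 0.
  by rewrite -size_xs; elim: (xs) => //= x ys ->; rewrite /f mul0r scale0r.
by rewrite -/a0 addrAC addrr_F2 add0r.
Qed.

End StarShaped.

Section Compactness.
Variable R : realType.

Lemma lebesgue_number (W : normedModType R) I (A : set W) (U : I -> set W) :
  compact A -> (forall x, A x -> exists i, nbhs x (U i)) ->
  exists2 e : R, 0 < e & forall x, A x -> exists i, forall y, `|x - y| <= e -> U i y.
Proof.
move=> /compact_near_coveringP A_compact A_cover.
have : \forall e \near 0^'+, A `<=` [set x | exists i, forall y, `|x - y| <= e -> U i y].
  apply: A_compact => x /A_cover[i /nbhs_ballP[r /= r0 ballU]].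
  near=> x' e => /=; exists i => y x'y; apply: ballU; rewrite -ball_normE /=.
  rewrite (le_lt_trans (ler_distD x' _ _)) // (splitr r) ltrD //.
    near: x'; apply/nbhs_ballP; exists (r / 2); first by rewrite /= divr_gt0.
    by move=> z; rewrite -ball_normE.
  apply: (le_lt_trans x'y); near: e; apply: nbhs_right_lt; exact: divr_gt0.
move=> A_near; near ((0 : R)^'+) => e; exists e; first by near: e; exact: nbhs_right_gt.
by move=> x Ax; apply: (near A_near e).
Unshelve. all: by end_near. Qed.

Lemma compact_unif_continuous (W W' : normedModType R) (A : set W) (f : W -> W') (e : R) :
  compact A -> {within A, continuous f} -> 0 < e ->
  exists2 d : R, 0 < d & forall x y, A x -> A y -> `|x - y| <= d -> `|f x - f y| <= e.
Proof.
move=> A_compact f_cont e0; have e20 : 0 < e / 2 by rewrite divr_gt0.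
pose U z := [set y | A y -> `|f z - f y| <= e / 2].
have [x Ax|d d0 dU] := @lebesgue_number W W A U A_compact.
  exists x; have /cvgrPdist_le/(_ _ e20) := (iffLR (subspace_continuousP _ _) f_cont) x Ax.
  by rewrite near_withinE.
exists d => // x y Ax Ay xy; have [z zU] := dU x Ax.
rewrite (le_trans (ler_distD (f z) _ _)) // (splitr e) lerD //; last exact: zU.
by rewrite distrC; apply: zU; rewrite // subrr normr0 ltW.
Qed.

Lemma small_acyclic_retract (W W' : normedModType R) (A : set W) (B : set W')
    (f : W -> W') (g : W' -> W) n :
  compact A -> compact B -> (forall x, A x -> B (f x)) -> (forall y, B y -> A (g y)) ->
  (forall x, A x -> g (f x) = x) -> {within A, continuous f} -> {within B, continuous g} ->
  small_acyclic B n -> small_acyclic A n.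
Proof.
move=> A_compact B_compact fB gA gK f_cont g_cont B_acyclic a e e0 a_cocycle.
have [e' e'0 g_unif] := compact_unif_continuous B_compact g_cont e0.
have [|b [d d0 b_prim]] := B_acyclic (fun ys => a (map g ys)) e' e'0.
  move=> ys size_ys ysB ys_small; rewrite cobd_comp_map.
  exact: (eq_small_comp gA g_unif a_cocycle).
have [d' d'0 f_unif] := compact_unif_continuous A_compact f_cont d0.
exists (fun xs => b (map f xs)), d' => // xs size_xs xsA xs_small.
rewrite cobd_comp_map (eq_small_comp fB f_unif b_prim) // -map_comp map_id_in // => x /xsA.
exact: gK.
Qed.

Lemma continuous_linear_row n (W : normedModType R) (c : 'I_n -> W) :
  continuous (fun w : 'rV[R]_n => \sum_i w ord0 i *: c i).
Proof.
apply: (continuous_big add_continuous) => i _ w.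
apply: (@cvgZr_tmp R W _ (nbhs w) _ (fun w : 'rV[R]_n => w ord0 i)).
exact: (@coord_continuous R 1 n ord0 i w).
Qed.

Definition standard_simplex n : set 'rV[R]_n :=
  [set w | (forall i, 0 <= w ord0 i) /\ \sum_i w ord0 i = 1].

Lemma rV_norm_le n (x : 'rV[R]_n) M : 0 <= M -> (forall i, `|x ord0 i| <= M) -> `|x| <= M.
Proof.
move=> M0 xM; rewrite [`|x|]mx_normrE; apply/bigmax_leP; split => // -[i j] _ /=.
by rewrite ord1.
Qed.

Lemma closed_norm_le_compact n (A : set 'rV[R]_n) M :
  closed A -> (forall x, A x -> `|x| <= M) -> compact A.
Proof.
move=> A_closed AM; apply: bounded_closed_compact A_closed.
by exists M; split => [|M' /ltW M_le x /AM /le_trans]; [exact: num_real | apply].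
Qed.

Lemma compact_standard_simplex n : compact (@standard_simplex n).
Proof.
apply: (@closed_norm_le_compact _ _ 1) => [|w [w0 w1]]; last first.
  by apply: rV_norm_le => // i; rewrite ger0_norm // -w1 (bigD1 i) //= lerDl sumr_ge0.
have -> : @standard_simplex n =
    \bigcap_(i : 'I_n) ((fun w : 'rV[R]_n => w ord0 i) @^-1` [set y | 0 <= y]) `&`
    (fun w : 'rV[R]_n => \sum_i w ord0 i) @^-1` [set y | y = 1].
  apply/seteqP; split => [w [w0 w1]|w [w0 w1]]; split=> // i; [by move=> _; exact: w0 | exact: w0].
apply: closedI.
  apply: closed_bigI => i _; apply: preimage_closed; last exact: closed_ge.
  by move=> w _; exact: coord_continuous.
apply: preimage_closed; last exact: closed_eq.
move=> w _; apply: (continuous_big add_continuous) => i _.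
exact: (@coord_continuous R 1 n ord0 i).
Qed.

Lemma norm_closed_unit_ball (x : 'rV[R]_3) : closed_unit_ball x -> `|x| <= 1.
Proof.
move=> xB; apply: rV_norm_le => // i; rewrite -(@expr_le1 _ 2) //; apply: le_trans xB.
by rewrite (bigD1 i) //= real_normK ?num_real // lerDl sumr_ge0 // => k _; apply: sqr_ge0.
Qed.

Lemma compact_closed_unit_ball : compact (@closed_unit_ball R).
Proof.
apply: closed_norm_le_compact norm_closed_unit_ball.
have -> : @closed_unit_ball R =
    (fun x : 'rV[R]_3 => \sum_i x ord0 i ^+ 2) @^-1` [set y | y <= 1] by [].
apply: preimage_closed; last exact: closed_le.
move=> x _; apply: (continuous_big add_continuous) => i _ y.
have coord := @coord_continuous R 1 3 ord0 i y; exact: (cvgM coord coord).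
Qed.

Lemma small_acyclic_closed_unit_ball n : small_acyclic (@closed_unit_ball R) n.
Proof.
apply: small_acyclic_star norm_closed_unit_ball _ => [|x t xB /andP[t0 t1]].
  by rewrite /closed_unit_ball /= big1 // => i _; rewrite mxE expr0n.
rewrite /closed_unit_ball /=; under eq_bigr do rewrite mxE exprMn.
rewrite -mulr_sumr mulr_ile1 ?exprn_ge0 ?exprn_ile1 //.
by apply: sumr_ge0 => i _; apply: sqr_ge0.
Qed.

End Compactness.

(** * Triangulated domains *)

Lemma expr_mul_le_ex (R : realType) (q D d : R) : 0 <= q < 1 -> 0 <= D -> 0 < d ->
  exists N, q ^+ N * D <= d.
Proof.
move=> /andP[q0 q1] D0 d0; have D1 : 0 < D + 1 by rewrite ltr_wpDl.
have : (fun n => q ^+ n) @ \oo --> (0 : R) by apply: cvg_expr; rewrite ger0_norm.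
move=> /cvgrPdist_lt /(_ (d / (D + 1)) (divr_gt0 d0 D1)) [N _ /(_ N (leqnn N))] /=.
rewrite sub0r normrN ger0_norm ?exprn_ge0 // ltr_pdivlMr // => qN.
exists N; apply: ltW; apply: le_lt_trans qN; rewrite ler_wpM2l ?exprn_ge0 //.
by rewrite lerDl.
Qed.

Section ConvexHulls.
Variables (R : realType) (V : finType) (pos : V -> 'rV[R]_3).
Implicit Types s : {set V}.

Lemma sum_enum_val (U : nmodType) s (F : V -> U) : (forall v, v \notin s -> F v = 0) ->
  \sum_v F v = \sum_(i < #|s|) F (enum_val i).
Proof.
move=> F0; rewrite (bigID (mem s)) /= [X in _ + X]big1 // addr0.
by rewrite -(big_enum_val F).
Qed.

Lemma conv_hull0 x : ~ conv_hull pos finset.set0 x.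
Proof.
case=> w [_ w_out w1 _]; move: w1; rewrite big1 => [/eqP|v _]; last by rewrite w_out ?inE.
by rewrite eq_sym oner_eq0.
Qed.

Lemma conv_hull_vertex s v : v \in s -> conv_hull pos s (pos v).
Proof.
move=> vs; exists (fun u => (u == v)%:R); split.
- by move=> u; rewrite ler0n.
- by move=> u; case: eqP => // ->; rewrite vs.
- by rewrite (bigD1 v) //= eqxx big1 ?addr0 // => u /negPf->.
- rewrite (bigD1 v) //= eqxx scale1r big1 ?addr0 // => u /negPf->.
  by rewrite scale0r.
Qed.

Lemma compact_conv_hull s : compact (conv_hull pos s).
Proof.
have -> : conv_hull pos s =
    (fun w : 'rV[R]_#|s| => \sum_i w ord0 i *: pos (enum_val i)) @` @standard_simplex R #|s|.
  apply/seteqP; split => [x [w [w0 w_out w1 ->]]|_ [w [w0 w1] <-]].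
    exists (\row_i w (enum_val i)).
      split=> [i|]; first by rewrite mxE.
      by rewrite -w1 (sum_enum_val w_out); apply: eq_bigr => i _; rewrite mxE.
    rewrite (sum_enum_val (s := s)) => [|v /w_out->]; last by rewrite scale0r.
    by apply: eq_bigr => i _; rewrite mxE.
  have [c c_out w_c] := row_enum_valP w; rewrite {}w_c in w0 w1 *; exists c; split=> //.
  - move=> v; have [vs|/c_out-> //] := boolP (v \in s).
    by have := w0 (enum_rank_in vs v); rewrite mxE enum_rankK_in.
  - by rewrite -w1 (sum_enum_val c_out); apply: eq_bigr => i _; rewrite mxE.
  - rewrite [RHS](sum_enum_val (s := s)) => [|v /c_out->]; last by rewrite scale0r.
    by apply: eq_bigr => i _; rewrite mxE.
apply: continuous_compact; last exact: compact_standard_simplex.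
by apply: continuous_subspaceT; exact: continuous_linear_row.
Qed.

Lemma compact_polyhedron K : compact (polyhedron pos K).
Proof.
have -> : polyhedron pos K = \bigcup_(s in [set` K]) conv_hull pos s by [].
rewrite bigcup_pred; apply: bigsetU_compact => s _; exact: compact_conv_hull.
Qed.

Lemma bary_closed_conv_hull s : bary_closed (conv_hull pos s).
Proof.
move=> xs size_gt0 xs_s; have size0 : (size xs)%:R != 0 :> R by rewrite pnatr_eq0 -lt0n.
have /choice[w wP] : forall x, exists w : V -> R, conv_hull pos s x ->
    [/\ forall v, 0 <= w v, forall v, v \notin s -> w v = 0, \sum_v w v = 1 &
        x = \sum_v w v *: pos v].
  move=> x; have [[w wx]|nx] := pselect (conv_hull pos s x); first by exists w.
  by exists (fun=> 0) => /nx.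
exists (fun v => (size xs)%:R^-1 * \sum_(x <- xs) w x v); split.
- move=> v; rewrite mulr_ge0 ?invr_ge0 // big_seq; apply: sumr_ge0 => x /xs_s/wP[+ _ _ _].
  exact.
- move=> v vs; rewrite big_seq big1 ?mulr0 // => x /xs_s/wP[_ + _ _].
  exact.
- rewrite -mulr_sumr exchange_big big_seq (eq_bigr (fun=> 1)) => [|x /xs_s/wP[]//].
  by rewrite -big_seq big_const_seq count_predT iter_addr_0 mulVf.
- rewrite /bary; under [RHS]eq_bigr do rewrite -scalerA scaler_suml.
  rewrite -scaler_sumr exchange_big; congr (_ *: _); rewrite [LHS]big_seq [RHS]big_seq.
  by apply: eq_bigr => x /xs_s/wP[_ _ _ {1}->].
Qed.

Lemma small_vertices (s : {set V}) :
  small (\sum_u \sum_v `|pos u - pos v|) (map pos (enum s)).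
Proof.
move=> _ _ /mapP[u _ ->] /mapP[v _ ->].
rewrite (bigD1 u) //= (bigD1 v) //= -addrA lerDl addr_ge0 ?sumr_ge0 // => w _.
exact: sumr_ge0.
Qed.

Lemma map_pos_conv_hull s x : x \in map pos (enum s) -> conv_hull pos s x.
Proof. by case/mapP=> v; rewrite mem_enum => vs ->; exact: conv_hull_vertex. Qed.

End ConvexHulls.

Section Labellings.
Variables (R : realType) (V : finType) (K : {set {set V}}) (pos : V -> 'rV[R]_3).
Hypothesis Kcx : is_simplicial_complex K.
Hypothesis Kgeo : geometric_realization pos K.
Implicit Types (s t : {set V}) (x : 'rV[R]_3) (c : {set V} -> 'F_2) (lab : 'rV[R]_3 -> V).

Definition vertex_labelling lab :=
  forall s x, s \in K -> conv_hull pos s x -> lab x \in s.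

Definition open_star v : set 'rV[R]_3 :=
  ~` \bigcup_(s in [set s | (s \in K) && (v \notin s)]) conv_hull pos s.

Lemma open_starP v x s : open_star v x -> s \in K -> conv_hull pos s x -> v \in s.
Proof. by move=> vx sK sx; apply: contra_notT vx => vs; exists s => //=; rewrite sK. Qed.

Lemma nbhs_open_star v x : open_star v x -> nbhs x (open_star v).
Proof.
move=> vx; apply: open_nbhs_nbhs; split=> //; apply: closed_openC; apply: closed_bigcup.
  exact: finite_finset.
move=> s _; apply: compact_closed; first exact: norm_hausdorff.
exact: compact_conv_hull.
Qed.

Lemma open_star_cover x : polyhedron pos K x -> exists v, open_star v x.
Proof.
case=> s0 s0K s0x; pose P s := (s \in K) && `[< conv_hull pos s x >].
have P0 : P s0 by rewrite /P s0K; apply/asboolP.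
case: (@arg_minnP _ s0 P (fun s => #|s|) P0) => s /andP[sK /asboolP sx] s_min.
have /set0Pn[v vs] : s != finset.set0 by rewrite -card_gt0 (complex_card_gt0 Kcx).
exists v => -[t /andP[tK /negP vt] tx]; apply: vt.
have stx : conv_hull pos (s :&: t) x by rewrite -(proj2 Kgeo).
have stK : s :&: t \in K.
  apply: complex_down Kcx sK (subsetIl _ _) _; rewrite card_gt0.
  by apply: contraPneq stx => ->; exact: conv_hull0.
have /s_min card_st : P (s :&: t) by rewrite /P stK; apply/asboolP.
have /eqP st : s :&: t == s by rewrite eqEcard subsetIl card_st.
by move: vs; rewrite -st inE => /andP[].
Qed.

Lemma ex_vertex_labelling : K != finset.set0 ->
  exists (e : R) lab, [/\ 0 < e, vertex_labelling lab &
    forall xs, (0 < size xs)%N -> (forall x, x \in xs -> polyhedron pos K x) ->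
      small e xs -> [set:: map lab xs] \in K].
Proof.
case/set0Pn=> s0 s0K; have /card_gt0P[v0 _] := complex_card_gt0 Kcx s0K.
have [|e e0 e_star] := @lebesgue_number _ _ _ _ open_star (@compact_polyhedron R V pos K).
  by move=> x /open_star_cover[v vx]; exists v; exact: nbhs_open_star.
have /choice[lab labP] : forall x, exists v, polyhedron pos K x ->
    forall y, `|x - y| <= e -> open_star v y.
  move=> x; have [/e_star[v vP]|nx] := pselect (polyhedron pos K x); first by exists v.
  by exists v0 => /nx.
exists e, lab; split=> // [s x sK sx|[//|x xs] _ xsK xs_small].
  by apply: (open_starP (labP x _ x _) sK sx); [exists s | rewrite subrr normr0 ltW].
have [s sK sx] := xsK x (mem_head _ _).
apply: (complex_down Kcx sK); last by apply/card_gt0P; exists (lab x); rewrite inE mem_head.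
apply/fintype.subsetP => v; rewrite inE => /mapP[y y_xs ->].
by apply: (open_starP (labP y (xsK y y_xs) x _) sK sx); apply: xs_small; rewrite ?mem_head.
Qed.

(* Sperner's lemma: subdividing and relabelling is the identity on cochains,
   because it commutes with coboundaries and preserves dimension. *)
Lemma sperner N lab s c : vertex_labelling lab -> s \in K \/ s = finset.set0 ->
  iter N (sd (@bary R _)) (fun ys => list_cochain c (map lab ys)) (map pos (enum s)) = c s.
Proof.
move=> labP; move card_s: #|s| => n; elim: n s c card_s => [|n IH] s c card_s s_K.
  have /eqP : s == finset.set0 by rewrite -cards_eq0 card_s.
  by move=> ->; rewrite enum_set0 iter_sd_nil /list_cochain /= finset.set_nil.
have /set0Pn[v0 v0s] : s != finset.set0 by rewrite -card_gt0 card_s.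
have {s_K}sK : s \in K by case: s_K => // s0; rewrite s0 cards0 in card_s.
pose b t := if t == s :\ v0 then c s else 0.
have b_s : scobd b s = c s.
  rewrite /scobd (bigD1 v0) //= {1}/b eqxx big1 ?addr0 // => v /andP[vs vv0].
  by rewrite /b; case: eqP => // /(setD1_inj vs v0s) /eqP; rewrite (negPf vv0).
transitivity (iter N (sd (@bary R _)) (cobd (fun ys => list_cochain b (map lab ys)))
    (map pos (enum s))).
  apply: (eq_small_iter_sd (n := #|s|) (@bary_closed_conv_hull _ _ pos s)); last first.
  - exact: small_vertices.
  - exact: map_pos_conv_hull.
  - by rewrite size_map -cardE.
  move=> ys size_ys ys_s _; rewrite (cobd_comp_map lab (list_cochain b)) cobd_list_cochain.
  rewrite /list_cochain; case: ifP => // uniq_ys; suff -> : [set:: map lab ys] = s by [].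
  apply/eqP; rewrite eqEcard cardsE (card_uniqP uniq_ys) size_map size_ys leqnn andbT.
  by apply/fintype.subsetP => v; rewrite inE => /mapP[y /ys_s sy ->]; exact: labP sy.
rewrite iter_sd_cobd -(cobd_comp_map pos) cobd_enum -b_s; apply: eq_bigr => v vs.
have card_sv : #|s :\ v| = n by move: card_s; rewrite (cardsD1 v) vs => -[].
apply: IH => //; have [->|sv0] := eqVneq (s :\ v) finset.set0; first by right.
by left; apply: complex_down Kcx sK (subD1set _ _) _; rewrite card_gt0.
Qed.

Lemma small_acyclic_exact_at n : small_acyclic (polyhedron pos K) n -> exact_at K n.
Proof.
case: n => [_ c _|n X_acyclic c c_cocycle].
  by exists (fun=> 0) => s sK card_s; have := complex_card_gt0 Kcx sK; rewrite card_s.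
have [->|K0] := eqVneq K finset.set0; first by exists (fun=> 0) => s; rewrite inE.
have [e [lab [e0 labP lab_small]]] := ex_vertex_labelling K0.
have [|b [d d0 b_prim]] := X_acyclic (fun ys => list_cochain c (map lab ys)) e e0.
  move=> ys size_ys ysX ys_small; rewrite cobd_comp_map cobd_list_cochain /list_cochain.
  case: ifP => // uniq_ys; apply: c_cocycle.
    by apply: lab_small; rewrite ?size_ys.
  by rewrite cardsE (card_uniqP uniq_ys) size_map.
pose D := \sum_u \sum_v `|pos u - pos v|.
have [||//|N ND] := @expr_mul_le_ex R (1 - n.+1%:R^-1) D d.
- by rewrite subr_ge0 invf_le1 ?ltr0n // ler1n gtrBl invr_gt0 ltr0n.
- by do 2!apply: sumr_ge0 => ? _.
exists (fun s => iter N (sd (@bary R _)) b (map pos (enum s))) => s sK card_s.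
rewrite /scobd -(cobd_enum (fun vs => iter N (sd (@bary R _)) b (map pos vs))).
rewrite (cobd_comp_map pos) -iter_sd_cobd -(sperner N c labP (or_introl sK)).
apply: (eq_small_iter_sd (n := n.+1) (@bary_closed_conv_hull _ _ pos s)); last first.
- exact: small_vertices.
- exact: map_pos_conv_hull.
- by rewrite size_map -cardE.
by apply: eq_small_sub b_prim => // x sx; exists s.
Qed.

Lemma homeomorphic_ball_exact_at n :
  homeomorphic (polyhedron pos K) (@closed_unit_ball R) -> exact_at K n.
Proof.
case=> f [g [[fX gB] gK _ f_cont g_cont]]; apply: small_acyclic_exact_at.
apply: (small_acyclic_retract _ _ _ _ gK f_cont g_cont (@small_acyclic_closed_unit_ball R n)).
- exact: compact_polyhedron.
- exact: compact_closed_unit_ball.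
- by move=> x Kx; apply: fX; exists x.
- by move=> y By; apply: gB; exists y.
Qed.

End Labellings.

(** * Tetrahedra around a triangle *)

Section TetrahedraAtTriangle.
Variables (R : realType) (V : finType) (K : {set {set V}}) (pos : V -> 'rV[R]_3).
Hypothesis Kgeo : geometric_realization pos K.
Implicit Types (s t f : {set V}) (u v x y z : V) (w : V -> R).

Definition affine_dep w := \sum_v w v = 0 /\ \sum_v w v *: pos v = 0.

Lemma affine_depB w w' : affine_dep w -> affine_dep w' -> affine_dep (fun v => w v - w' v).
Proof.
move=> [w0 wpos] [w'0 w'pos]; split; first by rewrite sumrB w0 w'0 subrr.
by under eq_bigr do rewrite scalerBl; rewrite sumrB wpos w'pos subrr.
Qed.

Lemma affine_depZ (a : R) w : affine_dep w -> affine_dep (fun v => a * w v).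
Proof.
move=> [w0 wpos]; split; first by rewrite -mulr_sumr w0 mulr0.
by under eq_bigr do rewrite -scalerA; rewrite -scaler_sumr wpos scaler0.
Qed.

Lemma conv_hull_normalize s w : 0 < \sum_v w v -> (forall v, 0 <= w v) ->
  (forall v, v \notin s -> w v = 0) ->
  conv_hull pos s ((\sum_v w v)^-1 *: \sum_v w v *: pos v).
Proof.
move=> w_gt0 w0 w_out; exists (fun v => (\sum_v w v)^-1 * w v); split.
- by move=> v; rewrite mulr_ge0 // invr_ge0 ltW.
- by move=> v /w_out ->; rewrite mulr0.
- by rewrite -mulr_sumr mulVf ?gt_eqF.
- by rewrite scaler_sumr; apply: eq_bigr => v _; rewrite scalerA.
Qed.

Lemma aff_indep_coord_inj s w w' : aff_indep pos s ->
  (forall v, v \notin s -> w v = 0) -> (forall v, v \notin s -> w' v = 0) ->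
  \sum_v w v = \sum_v w' v -> \sum_v w v *: pos v = \sum_v w' v *: pos v -> w =1 w'.
Proof.
move=> s_indep w_out w'_out w_w' wpos_w' v; apply/subr0_eq.
apply: (s_indep (fun u => w u - w' u)) => [u us||].
- by rewrite w_out ?w'_out ?subrr.
- by rewrite sumrB w_w' subrr.
- by under eq_bigr do rewrite scalerBl; rewrite sumrB wpos_w' subrr.
Qed.

(* Up to scaling, the positive and the negative part of [w] are barycentric coordinates of
   one and the same point, which therefore lies in the convex hull of [s :&: t]. *)
Lemma affine_dep_neg_support s t w : s \in K -> t \in K -> affine_dep w ->
  (forall v, 0 < w v -> v \in s) -> (forall v, w v < 0 -> v \in t) ->
  forall v, w v < 0 -> v \in s.
Proof.
move=> sK tK [w0 wpos] w_s w_t v0 wv0.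
have w_posneg v : w v = w^\+ v - w^\- v by rewrite -{1}(funrposBneg w).
have pos_out v : v \notin s -> w^\+ v = 0.
  by move=> vs; apply/max_idPr; rewrite leNgt; apply: contra vs => /w_s.
have neg_out v : v \notin t -> w^\- v = 0.
  by move=> vt; apply/max_idPr; rewrite oppr_le0 leNgt; apply: contra vt => /w_t.
have neg_v0 : 0 < w^\- v0 by rewrite lt_max oppr_gt0 wv0.
pose total := \sum_v w^\- v.
have total_gt0 : 0 < total.
  by rewrite /total (bigD1 v0) //= ltr_pwDl ?sumr_ge0 // => v _; exact: funrneg_ge0.
have total_pos : \sum_v w^\+ v = total.
  by apply/eqP; rewrite -subr_eq0 -sumrB -(eq_bigr _ (fun v _ => w_posneg v)) w0.
have same_point : \sum_v w^\+ v *: pos v = \sum_v w^\- v *: pos v.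
  apply/eqP; rewrite -subr_eq0 -sumrB -[X in _ == X]wpos; apply/eqP/eq_bigr => v _.
  by rewrite -scalerBl -w_posneg.
have in_t : conv_hull pos t (total^-1 *: \sum_v w^\- v *: pos v).
  by apply: conv_hull_normalize => // v; exact: funrneg_ge0.
have in_s : conv_hull pos s (total^-1 *: \sum_v w^\- v *: pos v).
  rewrite -same_point -total_pos; apply: conv_hull_normalize => [|v|//].
    by rewrite total_pos.
  exact: funrpos_ge0.
have [u [_ u_out u1 u_pos]] : conv_hull pos (s :&: t) (total^-1 *: \sum_v w^\- v *: pos v).
  by rewrite -(proj2 Kgeo).
have uE : (fun v => total^-1 * w^\- v) =1 u.
  apply: aff_indep_coord_inj (proj1 Kgeo t tK) _ _ _ _.
  - by move=> v /neg_out ->; rewrite mulr0.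
  - by move=> v vt; apply: u_out; rewrite inE negb_and vt orbT.
  - by rewrite u1 -mulr_sumr mulVf ?gt_eqF.
  - by rewrite -u_pos scaler_sumr; apply: eq_bigr => v _; rewrite scalerA.
have : v0 \in s :&: t.
  by apply: contraT => /u_out/eqP; rewrite -uE mulf_eq0 invr_eq0 !gt_eqF.
by rewrite inE => /andP[].
Qed.

Lemma affine_dep_ex s : (4 < #|s|)%N -> exists w,
  [/\ forall v, v \notin s -> w v = 0, affine_dep w & exists v, w v != 0].
Proof.
move=> card_s; pose A : 'M[R]_(#|s|, 3 + 1) := \matrix_i row_mx (pos (enum_val i)) (const_mx 1).
have : kermx A != 0.
  by rewrite -mxrank_eq0 mxrank_ker subn_eq0 -ltnNge (leq_ltn_trans (rank_leq_col A)).
case/rowV0Pn=> k /sub_kermxP; have [w w_out ->] := row_enum_valP k => kA k0.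
have {}kA : \sum_v w v *: row_mx (pos v) (const_mx 1) = 0 :> 'rV[R]_(3 + 1).
  rewrite (sum_enum_val (s := s)) => [|v /w_out ->]; last by rewrite scale0r.
  by rewrite -[RHS]kA mulmx_sum_row; apply: eq_bigr => i _; rewrite rowK mxE.
exists w; split=> //; last by case/rV0Pn: k0 => i; rewrite mxE; exists (enum_val i).
split.
  move/(congr1 rsubmx): kA; rewrite linear_sum linear0 => /matrixP/(_ 0 0).
  rewrite summxE mxE => kA; rewrite -[RHS]kA; apply: eq_bigr => v _.
  by rewrite linearZ /= row_mxKr !mxE mulr1.
move/(congr1 lsubmx): kA; rewrite linear_sum linear0 => kA; rewrite -[RHS]kA.
by apply: eq_bigr => v _; rewrite linearZ /= row_mxKl.
Qed.

Lemma apexes_not_opposite f x y w : x \notin f -> y \notin f -> x != y ->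
  x |: f \in K -> y |: f \in K -> affine_dep w ->
  (forall v, v \notin x |: (y |: f) -> w v = 0) -> 0 < w x -> 0 <= w y.
Proof.
move=> xf yf xy xK yK w_dep w_out wx; rewrite leNgt; apply/negP => wy.
have w_in v : w v != 0 -> [|| v == x, v == y | v \in f].
  by apply: contraR => v_out; rewrite w_out // !inE.
have : y \in x |: f; last by rewrite !inE eq_sym (negPf xy) (negPf yf).
apply: (affine_dep_neg_support xK yK w_dep _ _ wy) => v wv; rewrite !inE.
  have := w_in v (lt0r_neq0 wv); case: eqP => //= _; case: eqP => //= vy.
  by move: wv; rewrite vy ltNge ltW.
have := w_in v (ltr0_neq0 wv); case: eqP => //= vx.
by move: wv; rewrite vx ltNge ltW.
Qed.

Lemma apexes_same_sign f x y : #|f| = 3%N ->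
  x \notin f -> y \notin f -> x != y -> x |: f \in K -> y |: f \in K ->
  exists w, [/\ forall v, v \notin x |: (y |: f) -> w v = 0, affine_dep w, w x = 1 & 0 < w y].
Proof.
move=> card_f xf yf xy xK yK.
have x_yf : x \notin y |: f by rewrite !inE negb_or xy.
have [|w [w_out w_dep [v0 wv0]]] := @affine_dep_ex (x |: (y |: f)).
  by rewrite !cardsU1 x_yf yf card_f.
have nonzero s z : s \in K -> (forall v, v \notin z |: s -> w v = 0) -> w z != 0.
  move=> sK w_out_s; apply: contraNneq wv0 => wz; apply/eqP; have [w0 wpos] := w_dep.
  apply: (proj1 Kgeo s sK w _ w0 wpos) => v vs; have [->//|vz] := eqVneq v z.
  by apply: w_out_s; rewrite !inE negb_or vz.
have wx : w x != 0 by apply: nonzero yK w_out.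
have wy : w y != 0 by apply: (nonzero _ y xK) => v; rewrite finset.setUCA; exact: w_out.
have w'_out v : v \notin x |: (y |: f) -> (w x)^-1 * w v = 0 by move=> /w_out ->; rewrite mulr0.
have w'x : (w x)^-1 * w x = 1 by rewrite mulVf.
have w'_dep := affine_depZ (w x)^-1 w_dep.
exists (fun v => (w x)^-1 * w v); split=> //.
rewrite lt0r mulf_neq0 ?invr_neq0 //=.
by apply: (apexes_not_opposite xf yf xy xK yK w'_dep w'_out); rewrite w'x.
Qed.

Lemma triangle_cofaces_le2 f : #|f| = 3%N -> (#|[set t in K | facet f t]| <= 2)%N.
Proof.
move=> card_f; rewrite leqNgt; apply/negP => /card_gt2P[t1 [t2 [t3]]].
have apex t : t \in [set t in K | facet f t] ->
    exists x, [/\ x \notin f, t = x |: f & x |: f \in K].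
  rewrite inE => /andP[tK /facetP[x xt f_def]]; exists x.
  by rewrite f_def finset.setD1K // finset.setD11.
case=> [[/apex[x [xf -> xK]] /apex[y [yf -> yK]] /apex[z [zf -> zK]]] [t12 t23 t31]].
have xy : x != y by apply: contraNneq t12 => ->.
have yz : y != z by apply: contraNneq t23 => ->.
have zx : z != x by apply: contraNneq t31 => ->.
have [w [w_out w_dep wx wy]] := apexes_same_sign card_f xf yf xy xK yK.
have [|u [u_out u_dep ux uz]] := apexes_same_sign card_f xf zf _ xK zK; first by rewrite eq_sym.
have uy : u y = 0 by apply: u_out; rewrite !inE !negb_or yz yf eq_sym xy.
have wz : w z = 0 by apply: w_out; rewrite !inE !negb_or zx zf eq_sym yz.
have wu_out v : v \notin y |: (z |: f) -> w v - u v = 0.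
  rewrite !inE !negb_or => /and3P[vy vz vf]; have [->|vx] := eqVneq v x.
    by rewrite wx ux subrr.
  by rewrite w_out ?u_out ?subrr // !inE !negb_or vx ?vy ?vz.
have := apexes_not_opposite yf zf yz yK zK (affine_depB w_dep u_dep) wu_out.
by rewrite uy wz subr0 sub0r oppr_ge0 leNgt uz => /(_ wy).
Qed.

End TetrahedraAtTriangle.

Theorem theorem4 (R : realType) (V : finType) (K : {set {set V}})
  (pos : V -> 'rV[R]_3) (or : {set V} -> bool) :
  is_simplicial_complex K ->
  complex_dim K 3 ->
  geometric_realization pos K ->
  lipschitz_boundary (polyhedron pos K) ->
  homeomorphic (polyhedron pos K) (@closed_unit_ball R) ->
  collapsible K <->
  exists M : {set {set V} * {set V}},
    [/\ matching1 K M, acyclic1 M & complete1 R K or M].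
Proof.
move=> Kcx [[t [tK card_t]] Kd] Kgeo _ Kball.
have ex n := homeomorphic_ball_exact_at Kcx Kgeo (n := n) Kball.
have K_conn : edge_connected K by apply: exact_at1_edge_connected; exact: ex.
have vertices : (0 < #|simplices K 0|)%N.
  have /card_gt0P[v vt] : (0 < #|t|)%N by rewrite card_t.
  apply/card_gt0P; exists [set v]%SET; apply/simplices0P; exists v => //.
  exact: complex_vertex Kcx tK vt.
have rank_C := rank_face_edge_matrix or Kcx R K_conn (ex 2) vertices.
split=> [/(collapsible_matching Kcx)[M [M_match acM card_M]]|[M [M_match acM M_complete]]].
  by exists M; split=> //; apply/eqP; rewrite -(eqn_add2r #|simplices K 0|) card_M rank_C.
rewrite -M_complete in rank_C.
apply: (complete_matching_collapsible Kcx Kd K_conn) M_match acM => //.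
- by move=> f /simplicesP[_]; exact: (triangle_cofaces_le2 Kgeo).
- by move=> S; exact: exact_at_top_cycle Kd (ex 4).
- by rewrite M_complete; exact: exact_at_card_le (ex 3).
Qed.
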